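(* Let $\mu$ be a complete Radon measure on a metric space $X$ which has finite Assouad dimension. Consider a Lipschitz function $f\colon X\to\mathbb R^N$, points $\{v_i\}_{i=1}^N\subset\mathbb S^{N-1}$, and constants $\{\alpha_i\}_{i=1}^N\subset(0,\pi/2)$ and $\delta>0$. Suppose that $\mu$ admits Lipschitz Alberti representations $\{\mathcal A_i\}_{i=1}^N$ such that: (1) The Alberti representation $\mathcal A_i$ is in the $f$-direction of $\mathcal C(v_i,\alpha_i)$ with $\langle v_i,f\rangle$-speed $\ge\delta$. (2) For some $\theta>0$ the cone fields $\mathcal C(v_i,\alpha_i+\theta)$ are independent. Then there is a $\mu$-full measure Borel subset $U\subset X$ such that, for each $p\in U$ and for each blow-up $(Y,q,g)\in\operatorname{Tan}(X,p,f)$, the function $g\colon Y\to\mathbb R^N$ is surjective.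
   Context: $\mu$ complete means subsets of $\mu$-null sets are $\mu$-measurable. The Assouad dimension of a metric space is the infimum of the $D$ for which there is a constant $C$ such that, for each $\varepsilon\in(0,1)$ and $R>0$, every set of diameter $\le R$ can be covered by at most $C\varepsilon^{-D}$ sets of diameter $\le\varepsilon R$. Blow-ups: $\frac1tX$ denotes $X$ with metric multiplied by $1/t$. A blow-up of $X$ at $p$ is a complete pointed metric space $(Y,q)$ that is the pointed Gromov–Hausdorff limit of $(\frac1{t_n}X,p)$ for some $t_n\to0^+$; then all these pointed spaces can be isometrically embedded, basepoints to a common basepoint $z$, into a proper metric space $Z$ so that for each $R>0$, $\sup_{y\in B(z,R)\cap Y}\operatorname{dist}(\frac1{t_n}X,\{y\})\to0$ and $\sup_{x\in B(z,R)\cap\frac1{t_n}X}\operatorname{dist}(Y,\{x\})\to0$. Points $p_n'\in\frac1{t_n}X$ approximate $q'\in Y$ if $p_n'\to q'$ in $Z$. A blow-up of a Lipschitz $f\colon X\to\mathbb R^N$ at $p$ is a triple $(Y,q,g)$ where $(Y,q)$ is a blow-up of $X$ at $p$ realized by scales $t_n$, $g\colon Y\to\mathbb R^N$ is Lipschitz with $g(q)=0$, and whenever $p_n'$ approximates $q'$, $\lim_n(f(p_n')-f(p))/t_n=g(q')$. $\operatorname{Tan}(X,p,f)$ is the class of all blow-ups of $f$ at $p$. Cones: $\mathcal C(v,\alpha)=\{u\in\mathbb R^N:\tan\alpha\,\langle v,u\rangle>\|\pi_v^\perp u\|_2\}$ for $v\in\mathbb S^{N-1}$, $\alpha\in(0,\pi/2)$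 ($\pi_v^\perp$ the orthogonal projection onto the orthogonal complement of $v$). Cones $\mathcal C_1,\dots,\mathcal C_N$ are independent if any choice of $u_i\in\mathcal C_i\setminus\{0\}$ is linearly independent. (In (2) $\alpha_i+\theta<\pi/2$.) Fragments: a fragment in $X$ is a bi-Lipschitz map $\gamma\colon K\to X$ with $K=\operatorname{dom}\gamma\subset\mathbb R$ compact of positive Lebesgue measure; $\operatorname{Frag}(X)$ is the set of fragments, topologized by identifying $\gamma$ with its graph in the space of nonempty compact subsets of $\mathbb R\times X$ with the Hausdorff distance. The metric differential is $\operatorname{md}\gamma(t)=\lim_{\operatorname{dom}\gamma\ni t'\to t}d(\gamma(t'),\gamma(t))/|t'-t|$; $(f\circ\gamma)'(t)$ is likewise computed along $\operatorname{dom}\gamma$ (both exist for a.e. $t$). Alberti representations: an Alberti representation of $\mu$ is a pair $(P,\nu)$ where (1) $P$ is a regular Borel probability measure on $\operatorname{Frag}(X)$; (2) $\gamma\mapsto\nu_\gamma$ assigns to each fragment a finite nonnegative Borel measure on $X$, absolutely continuous with respect to the 1-dimensional Hausdorff measure on the image of $\gamma$, and $\gamma\mapsto\int h\,d\nu_\gamma$ is Borel for each $h\in C_c(X)$; (3) $\mu(A)=\int\nu_\gamma(A)\,dP(\gamma)$ for all Borel $A$; (4) for all Borel $A\subset X$ and reals $a\le b$, $\gamma\mapsto\nu_\gamma(A\cap\gamma(\operatorname{dom}\gamma\cap[a,b]))$ is Borel. It is Lipschitz if for some $C$ $P$-a.e. $\gamma$ is $C$-Lipschitz. It is in the $f$-direction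 of $\mathcal C(v,\alpha)$ if for $P$-a.e. $\gamma$ and a.e. $t\in\operatorname{dom}\gamma$, $(f\circ\gamma)'(t)\in\mathcal C(v,\alpha)$; for a real Lipschitz $h$ it has $h$-speed $\ge\delta$ if for $P$-a.e. $\gamma$ and a.e. $t\in\operatorname{dom}\gamma$, $(h\circ\gamma)'(t)\ge\delta\operatorname{md}\gamma(t)$. *)

(* Defs.v *)
From HB Require Import structures.
From mathcomp Require Import all_boot all_order all_algebra.
From mathcomp Require Import all_classical all_reals all_analysis measurable_realfun.

Set Implicit Arguments.
Unset Strict Implicit.
Unset Printing Implicit Defensive.

Import Order.TTheory GRing.Theory Num.Theory.
Import numFieldNormedType.Exports.

Local Open Scope classical_set_scope.
Local Open Scope ring_scope.

(* The measurable sets form an arbitrary sigma-algebra, a priori unrelated to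
   the topology: for a complete measure it is in general strictly larger than
   the Borel sets, which are the measurable sets of [borelType T].
   Measurable types being pointed, the space is nonempty. *)
#[short(type="metricMeasurableType")]
HB.structure Definition MetricMeasurable d (R : numDomainType) :=
  {T of Metric R T & Measurable d T}.

Notation borelType T := (g_sigma_algebraType (@open T)).

Definition radon d (R : realType) (X : metricMeasurableType d R)
    (mu : {measure set X -> \bar R}) : Prop :=
  [/\ (forall O : set X, open O -> measurable O),
      (forall x : X, exists2 O : set X, open_nbhs x O & (mu O < +oo)%E)
    & (forall A : set X, measurable A ->
        mu A = ereal_sup [set mu K | K in [set K | compact K /\ K `<=` A]])].

(* Outer regular for open sets and inner regular for compact sets. *)
Definition regular_borel (R : realType) (T : pseudoPMetricType R)
    (P : {measure set (borelType T) -> \bar R}) : Prop :=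
  forall A : set (borelType T), measurable A ->
    P A = ereal_inf [set P O | O in [set O : set T | open O /\ A `<=` O]] /\
    P A = ereal_sup [set P K | K in [set K : set T | compact K /\ K `<=` A]].

Definition diam (R : realType) (X : metricType R) (A : set X) : \bar R :=
  ereal_sup (0%E |` [set (mdist xy.1 xy.2)%:E | xy in A `*` A]).

Definition assouad_dim (R : realType) (X : metricType R) : \bar R :=
  ereal_inf [set D%:E | D in [set D : R |
    exists C : R, forall eps r : R, 0 < eps < 1 -> 0 < r ->
      forall A : set X, (diam A <= r%:E)%E ->
        exists2 n : nat, n%:R <= C * eps `^ (- D) &
          exists2 U : 'I_n -> set X,
            (forall i, (diam (U i) <= (eps * r)%:E)%E) & A `<=` \bigcup_i U i]].

Definition hausdorff1_delta (R : realType) (X : metricType R) (delta : R)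
    (A : set X) : \bar R :=
  ereal_inf [set (\sum_(0 <= k <oo) diam (U k))%E | U in
    [set U : nat -> set X |
      (forall k, diam (U k) <= delta%:E)%E /\ A `<=` \bigcup_k U k]].

Definition hausdorff1 (R : realType) (X : metricType R) (A : set X) : \bar R :=
  ereal_sup [set hausdorff1_delta delta A | delta in [set delta | 0 < delta]].

(* The library norm on ['rV[R]_N] is the sup norm. *)
Definition dot (R : realType) N (u w : 'rV[R]_N) : R :=
  \sum_(i < N) u ord0 i * w ord0 i.

Definition norm2 (R : realType) N (u : 'rV[R]_N) : R := Num.sqrt (dot u u).

Definition euclid_lipschitz (R : realType) (X : metricType R) N (f : X -> 'rV[R]_N) :
    Prop :=
  exists L : R, forall x y, norm2 (f x - f y) <= L * mdist x y.

(* For a unit vector [v], the projection onto the orthogonal complement of [v]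
   is [u |-> u - <v, u> v]. *)
Definition cone (R : realType) N (v : 'rV[R]_N) (alpha : R) : set 'rV[R]_N :=
  [set u | norm2 (u - dot v u *: v) < tan alpha * dot v u].

Definition independent_cones (R : realType) N (C : 'I_N -> set 'rV[R]_N) :
    Prop :=
  forall u : 'I_N -> 'rV[R]_N,
    (forall i, (C i `\ 0) (u i)) -> free [tuple u i | i < N].

(* For nonempty bounded [A] and [B]: their Hausdorff distance is [< r]. *)
Definition hausdorff_lt (R : realType) (T : pseudoMetricType R)
    (A : set T) (r : R) (B : set T) : Prop :=
  exists2 s : R, s < r &
    (forall a, A a -> exists2 b, B b & ball a s b) /\
    (forall b, B b -> exists2 a, A a & ball b s a).

Lemma hausdorff_lt_center (R : realType) (T : pseudoMetricType R) (A : set T)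
  (r : R) : 0 < r -> hausdorff_lt A r A.
Proof.
move=> r0; have r20 : 0 < r / 2 by rewrite divr_gt0.
exists (r / 2); first by rewrite ltr_pdivrMr// ltr_pMr// ltr1n.
by split=> a Aa; exists a => //; exact: ball_center (PosNum r20).
Qed.

Lemma hausdorff_lt_sym (R : realType) (T : pseudoMetricType R) (A B : set T)
  (r : R) : hausdorff_lt A r B -> hausdorff_lt B r A.
Proof. by move=> [s sr [AB BA]]; exists s. Qed.

Lemma hausdorff_lt_triangle (R : realType) (T : pseudoMetricType R)
  (A B C : set T) (r1 r2 : R) :
  hausdorff_lt A r1 B -> hausdorff_lt B r2 C -> hausdorff_lt A (r1 + r2) C.
Proof.
move=> [s sr1 [AB BA]] [t tr2 [BC CB]]; exists (s + t); first exact: ltrD.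
split=> [a /AB[b /BC[c Cc bc] ab]|c /CB[b /BA[a Aa ba] cb]].
  by exists c => //; exact: ball_triangle ab bc.
by exists a => //; rewrite addrC; exact: ball_triangle cb ba.
Qed.

Definition bilipschitz (R : realType) (X : metricType R) (K : set R)
    (gamma : K -> X) : Prop :=
  exists2 L : R, 0 < L & forall s t : K,
    L^-1 * `|val s - val t| <= mdist (gamma s) (gamma t) <= L * `|val s - val t|.

Record frag (R : realType) (X : metricType R) := Frag {
  dom : set R ;
  frag_fun :> dom -> X ;
  dom_compact : compact dom ;
  dom_gt0 : (0 < lebesgue_measure dom)%E ;
  frag_bilipschitz : bilipschitz frag_fun }.

Section frag_topology.
Context {R : realType} {X : metricType R}.

(* The product [R * X] carries the max distance. *)
Definition frag_graph (gamma : frag X) : set (R * X) :=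
  [set (val s, gamma s) | s in [set: dom gamma]].

HB.instance Definition _ := gen_eqMixin (frag X).
HB.instance Definition _ := gen_choiceMixin (frag X).

Let frag_ball (gamma : frag X) (r : R) (gamma' : frag X) : Prop :=
  hausdorff_lt (frag_graph gamma) r (frag_graph gamma').

Let frag_ent : set_system (frag X * frag X) := entourage_ frag_ball.

HB.instance Definition _ := hasNbhs.Build (frag X) (nbhs_ frag_ent).

Let frag_ball_center (gamma : frag X) (e : R) :
  0 < e -> frag_ball gamma e gamma.
Proof. exact: hausdorff_lt_center. Qed.

Let frag_ball_sym (gamma gamma' : frag X) (e : R) :
  frag_ball gamma e gamma' -> frag_ball gamma' e gamma.
Proof. exact: hausdorff_lt_sym. Qed.

Let frag_ball_triangle (g1 g2 g3 : frag X) (e1 e2 : R) :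
  frag_ball g1 e1 g2 -> frag_ball g2 e2 g3 -> frag_ball g1 (e1 + e2) g3.
Proof. exact: hausdorff_lt_triangle. Qed.

HB.instance Definition _ := @Nbhs_isPseudoMetric.Build R (frag X)
  frag_ent erefl frag_ball frag_ball_center frag_ball_sym frag_ball_triangle
  erefl.

End frag_topology.

(* Measurable types of the library are pointed; [frag X] is, as soon as it is
   nonempty, in particular if it carries a probability measure. The base
   fragment [gamma0] plays no other role. *)
Definition pfrag (R : realType) (X : metricType R) (gamma0 : frag X) : Type :=
  frag X.

HB.instance Definition _ (R : realType) (X : metricType R) (gamma0 : frag X) :=
  PseudoMetric.copy (pfrag gamma0) (frag X).
HB.instance Definition _ (R : realType) (X : metricType R) (gamma0 : frag X) :=
  isPointed.Build (pfrag gamma0) gamma0.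

(* [s] ranges over the subtype [dom gamma], so that limits are computed along
   the domain. At an isolated point of [dom gamma] every [l] is a limit; these
   points are countably many, and the notion is only used almost everywhere. *)
Definition is_frag_derive (R : realType) (X : metricType R)
    (V : normedModType R) (f : X -> V) (gamma : frag X) (t : dom gamma)
    (l : V) : Prop :=
  (val s - val t)^-1 *: (f (gamma s) - f (gamma t)) @[s --> t^'] --> l.

Definition is_md (R : realType) (X : metricType R) (gamma : frag X)
    (t : dom gamma) (m : R) : Prop :=
  mdist (gamma s) (gamma t) / `|val s - val t| @[s --> t^'] --> m.

Definition ae_dom (R : realType) (X : metricType R) (gamma : frag X)
    (Q : dom gamma -> Prop) : Prop :=
  lebesgue_measure.-negligible [set val t | t in [set t | ~ Q t]].

Record alberti d (R : realType) (X : metricMeasurableType d R)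
    (mu : {measure set X -> \bar R}) := Alberti {
  alb_base : frag X ;
  alb_P : probability (borelType (pfrag alb_base)) R ;
  alb_nu : frag X -> {finite_measure set (borelType X) -> \bar R} ;
  alb_regular : regular_borel alb_P ;
  alb_abs_cont : forall gamma : frag X,
    alb_nu gamma `<<
      (fun A : set (borelType X) => hausdorff1 (A `&` range gamma)) ;
  alb_borel_integral : forall h : X -> R,
    continuous h -> compact (closure [set x | h x != 0]) ->
    measurable_fun [set: borelType (pfrag alb_base)] (fun gamma => \int[alb_nu gamma]_x (h x)%:E)%E ;
  alb_disintegration : forall A : set (borelType X), measurable A ->
    (mu A = \int[alb_P]_gamma alb_nu gamma A)%E ;
  alb_borel_portion : forall (A : set (borelType X)) (a b : R),
    measurable A -> a <= b ->
    measurable_fun [set: borelType (pfrag alb_base)] (fun gamma => alb_nu gamma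
        (A `&` [set gamma t | t in [set t : dom gamma | a <= val t <= b]])) }.

Section alberti_properties.
Context d (R : realType) (X : metricMeasurableType d R).
Variables (mu : {measure set X -> \bar R}) (A : alberti mu).

Definition alberti_lipschitz : Prop :=
  exists C : R, \forall gamma \ae alb_P A, forall s t : dom gamma,
    mdist (gamma s) (gamma t) <= C * `|val s - val t|.

Definition in_direction N (f : X -> 'rV[R]_N) (C : set 'rV[R]_N) : Prop :=
  \forall gamma \ae alb_P A, ae_dom (fun t : dom gamma =>
    exists2 l, is_frag_derive f t l & C l).

Definition has_speed_ge (h : X -> R) (delta : R) : Prop :=
  \forall gamma \ae alb_P A, ae_dom (fun t : dom gamma =>
    exists l m, [/\ is_frag_derive (h : X -> R^o) t l, is_md t m
                  & delta * m <= l]).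

End alberti_properties.

Definition complete_space (R : realType) (Y : metricType R) : Prop :=
  forall F : set_system Y, ProperFilter F -> cauchy F -> exists y : Y, F --> y.

Definition proper_space (R : realType) (Z : metricType R) : Prop :=
  forall (z : Z) (r : R), compact [set w | mdist z w <= r].

(* Pointed Gromov-Hausdorff convergence of [X], with its metric multiplied by
   [(t n)^-1], to [Y], realized by isometric embeddings [iota n] and [j] into a
   common proper space [Z]. Here [edist_inf A y] is the distance from [y] to
   [A]. *)
Record pGH_realization (R : realType) (X : metricType R) (p : X)
    (Y : metricType R) (q : Y) (t : nat -> R) (Z : metricType R) (z : Z)
    (iota : nat -> X -> Z) (j : Y -> Z) : Prop := {
  pGH_proper : proper_space Z ;
  pGH_isomX : forall n x y,
    mdist (iota n x) (iota n y) = (t n)^-1 * mdist x y ;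
  pGH_isomY : forall x y, mdist (j x) (j y) = mdist x y ;
  pGH_baseX : forall n, iota n p = z ;
  pGH_baseY : j q = z ;
  pGH_YX : forall r : R, 0 < r ->
    ereal_sup [set edist_inf (range (iota n)) y | y in ball z r `&` range j]
      @[n --> \oo] --> 0%E ;
  pGH_XY : forall r : R, 0 < r ->
    ereal_sup [set edist_inf (range j) x | x in ball z r `&` range (iota n)]
      @[n --> \oo] --> 0%E }.

(* [(Y, q, g)] belongs to the class of blow-ups of [f] at [p]; [p'] approximates
   [q'] through the embeddings of the realization. *)
Definition Tan (R : realType) (X : metricType R) (p : X) N
    (f : X -> 'rV[R]_N) (Y : metricType R) (q : Y) (g : Y -> 'rV[R]_N) : Prop :=
  [/\ complete_space Y, euclid_lipschitz g, g q = 0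
    & exists (t : nat -> R) (Z : metricType R) (z : Z)
        (iota : nat -> X -> Z) (j : Y -> Z),
      [/\ (forall n, 0 < t n), t n @[n --> \oo] --> (0 : R),
          pGH_realization p q t z iota j
        & forall (p' : nat -> X) (q' : Y),
            iota n (p' n) @[n --> \oo] --> j q' ->
            (t n)^-1 *: (f (p' n) - f p) @[n --> \oo] --> g q']].

(* Main.v *)
Require Import Defs.
From HB Require Import structures.
From mathcomp Require Import all_boot all_order all_algebra.
From mathcomp Require Import all_classical all_reals all_analysis measurable_realfun.
From mathcomp Require Import ring lra.

Set Implicit Arguments.
Unset Strict Implicit.
Unset Printing Implicit Defensive.

Import Order.TTheory GRing.Theory Num.Theory.
Import numFieldNormedType.Exports.

Local Open Scope classical_set_scope.
Local Open Scope ring_scope.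

(** The idea is to move the values of f towards a target by finitely many small
    jumps in X whose directions are chosen greedily, the number of jumps depending
    only on the precision and not on the scale.

    Call a jump from x to x' at scale s in the direction i with a sign admissible
    (step) when d(x, x') lies between s and 2s, the increment of f, up to the sign,
    lies in the closed cone of axis v_i and angle alpha_i, and its component along
    v_i is at least (delta/2) d(x, x'). At a parameter t of a fragment at which the
    derivatives exist, moving to a suitable nearby parameter on the chosen side of
    t gives an admissible jump. If S is compact and t is moreover a Lebesgue
    density point of the parameters that the fragment spends in S, the endpoint
    of the jump can be taken in S, at every small scale (frag_steps). Lipschitz
    images of Lebesgue-null sets are H^1-null, so the Alberti representations
    turn this into a statement about mu: almost every point of S lies in one of
    the sets T_n(S) of points from which, at every scale below 1/(n+1) and for
    every direction and sign, some admissible jump ends in S (core_null).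

    The endpoint of a jump from T_n(S) is only known to lie in S. But T_n(S) is
    again compact (compact_step_core), so the construction can be iterated: from
    almost every point, for every k, walks of k successive jumps with arbitrarily
    prescribed directions and signs exist at all small scales (walks_ae).

    Independence of the slightly wider cones says that no vector e <> 0 is
    orthogonal to one nonzero vector of each of them. Hence some closed cone lies,
    quantitatively, strictly on one side of the hyperplane orthogonal to e
    (independent_cones_escape). Taking for e the vector from f(x) to a target, a
    jump of that direction and sign decreases the distance to the target by an
    amount comparable to the scale. A number of jumps which depends only on the
    precision eps therefore brings f from f(p) within eps r of f(p) + r w, at a
    point at distance O(r) of p, for all small r (walk_reach).

    For r = t_n and a blow-up (Y, q, g) realized by the t_n, these points have a
    cluster point in the proper space into which everything is embedded. It lies
    in Y because Y is complete, and g takes the value w there (blowup_value). *)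

(** * Euclidean geometry and cones *)

Section euclidean.
Context {R : realType} {N : nat}.
Implicit Types (u w e v : 'rV[R]_N) (a b : R).

Lemma dotC u w : dot u w = dot w u.
Proof. by apply: eq_bigr => i _; rewrite mulrC. Qed.

Lemma dotDr e u w : dot e (u + w) = dot e u + dot e w.
Proof. by rewrite -big_split; apply: eq_bigr => i _; rewrite mxE mulrDr. Qed.

Lemma dotZr e a u : dot e (a *: u) = a * dot e u.
Proof. by rewrite big_distrr; apply: eq_bigr => i _; rewrite mxE/= mulrCA. Qed.

Lemma dotNr e u : dot e (- u) = - dot e u.
Proof. by rewrite -scaleN1r dotZr mulN1r. Qed.

Lemma dotBr e u w : dot e (u - w) = dot e u - dot e w.
Proof. by rewrite dotDr dotNr. Qed.

Lemma dotDl e u w : dot (u + w) e = dot u e + dot w e.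
Proof. by rewrite !(dotC _ e) dotDr. Qed.

Lemma dotZl e a u : dot (a *: u) e = a * dot u e.
Proof. by rewrite !(dotC _ e) dotZr. Qed.

Lemma dotBl e u w : dot (u - w) e = dot u e - dot w e.
Proof. by rewrite !(dotC _ e) dotBr. Qed.

Lemma dot_ge0 u : 0 <= dot u u.
Proof. by apply: sumr_ge0 => i _; rewrite -expr2 sqr_ge0. Qed.

Lemma norm2_ge0 u : 0 <= norm2 u. Proof. exact: sqrtr_ge0. Qed.

Lemma sqr_norm2 u : norm2 u ^+ 2 = dot u u.
Proof. by rewrite sqr_sqrtr// dot_ge0. Qed.

Lemma norm2_eq0 u : norm2 u = 0 -> u = 0.
Proof.
move=> u0; have : dot u u = 0 by rewrite -sqr_norm2 u0 expr0n.
move=> /psumr_eq0P h; apply/rowP => i; rewrite mxE.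
have /eqP := h (fun i _ => ltac:(by rewrite -expr2 sqr_ge0)) i isT.
by rewrite mulf_eq0 orbb => /eqP.
Qed.

Lemma norm2_gt0 u : u != 0 -> 0 < norm2 u.
Proof.
by move=> u0; rewrite lt_def norm2_ge0 andbT; apply: contra_neq u0 => /norm2_eq0.
Qed.

Lemma norm20 : norm2 (0 : 'rV[R]_N) = 0.
Proof. by rewrite /norm2 -(scale0r 0) dotZr mul0r sqrtr0. Qed.

Lemma norm2Z a u : norm2 (a *: u) = `|a| * norm2 u.
Proof. by rewrite /norm2 dotZr dotZl mulrA -expr2 sqrtrM ?sqr_ge0// sqrtr_sqr. Qed.

Lemma norm2N u : norm2 (- u) = norm2 u.
Proof. by rewrite -scaleN1r norm2Z normrN normr1 mul1r. Qed.

Lemma norm2_le u a : 0 <= a -> dot u u <= a ^+ 2 -> norm2 u <= a.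
Proof. by move=> a0 ua; rewrite -(ler_pXn2r (n:=2))// ?nnegrE ?norm2_ge0// sqr_norm2. Qed.

(** Expand the square of |w| u - |u| w. *)
Lemma cauchy_schwarz u w : dot u w <= norm2 u * norm2 w.
Proof.
have [->|/norm2_gt0 w0] := eqVneq w 0.
  by rewrite norm20 mulr0 -(scale0r 0) dotZr mul0r.
rewrite -(ler_pM2r w0).
have := dot_ge0 (norm2 w *: u - norm2 u *: w).
rewrite dotBr !dotBl !dotZr !dotZl -!sqr_norm2 (dotC w u) => h.
have [u0|u0] := leP (norm2 u) 0.
  have /eqP/norm2_eq0 -> : norm2 u == 0 by rewrite eq_le u0 norm2_ge0.
  by rewrite norm20 !mul0r dotC -(scale0r 0) dotZr !mul0r.
rewrite -(ler_pM2r u0); nra.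
Qed.

Lemma sqr_normB u w :
  dot (u - w) (u - w) = norm2 u ^+ 2 - 2 * dot u w + norm2 w ^+ 2.
Proof. by rewrite dotBr !dotBl -!sqr_norm2 (dotC w u); ring. Qed.

Lemma norm2D u w : norm2 (u + w) <= norm2 u + norm2 w.
Proof.
apply: norm2_le; first by rewrite addr_ge0 ?norm2_ge0.
rewrite dotDr !dotDl -!sqr_norm2 (dotC w u); have := cauchy_schwarz u w; nra.
Qed.

Lemma ler_abs_coord_norm2 u i : `|u ord0 i| <= norm2 u.
Proof.
rewrite -sqrtr_sqr ler_sqrt ?dot_ge0// expr2 /dot (bigD1 i)//= lerDl.
by apply: sumr_ge0 => j _; rewrite -expr2 sqr_ge0.
Qed.

(** Compares the Euclidean norm with the sup norm, from which the topology of the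
    space of row vectors comes. *)
Lemma ler_norm_norm2 u : `|u| <= norm2 u.
Proof.
have [->|u0] := eqVneq `|u| 0; first exact: norm2_ge0.
have [[i j]] := mx_norm_neq0 u0.
by rewrite /Num.norm/= => ->; rewrite (ord1 i) ler_abs_coord_norm2.
Qed.

Lemma dot_continuous v : continuous (dot v : 'rV[R]_N -> R^o).
Proof.
apply: continuous_big => [|i _ u]; first exact: (@pseudometric_normed_Zmodule.add_continuous R R^o).
by apply: continuousM; [exact: cst_continuous|exact: (@coord_continuous R _ _ ord0 i u)].
Qed.

Lemma norm2_continuous : continuous (@norm2 R N : 'rV[R]_N -> R^o).
Proof.
have dc : continuous ((fun u => dot u u) : 'rV[R]_N -> R^o).
  apply: continuous_big => [|i _ u]; first exact: (@pseudometric_normed_Zmodule.add_continuous R R^o).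
  by apply: continuousM; exact: (@coord_continuous R _ _ ord0 i u).
move=> u; apply: (@continuous_comp _ _ _ (fun u => dot u u) Num.sqrt).
  exact: dc.
exact: sqrt_continuous.
Qed.

Lemma dot_orth_proj v a u : norm2 v = 1 ->
  dot v (u - dot v u *: v) = 0.
Proof. by move=> v1; rewrite dotBr dotZr -sqr_norm2 v1 expr1n mulr1 subrr. Qed.

(** If the component of e orthogonal to v were too large compared with <v, e>, then v
    could be tilted along it by an angle less than b until it is orthogonal to e. *)
Lemma cone_orth_steep v e b : norm2 v = 1 -> 0 < tan b ->
  (forall u, (cone v b `\ 0) u -> dot e u != 0) ->
  tan b * norm2 (e - dot v e *: v) <= `|dot v e|.
Proof.
move=> v1 b0 h; rewrite leNgt; apply/negP => lt_e.
set a := dot v e in lt_e *; set e' := e - a *: v in lt_e.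
have ne'0 : 0 < norm2 e'.
  by rewrite -(pmulr_rgt0 _ b0) (le_lt_trans _ lt_e).
have ve' : dot v e' = 0 by exact: dot_orth_proj.
have ee' : dot e e' = norm2 e' ^+ 2.
  rewrite sqr_norm2 {2}/e' dotBl dotZl ve'; lra.
(* The point of the line through v along e' that is orthogonal to e. *)
pose u := v - (a / norm2 e' ^+ 2) *: e'.
have vu : dot v u = 1 by rewrite dotBr dotZr ve' -sqr_norm2 v1; lra.
suff /h/eqP : (cone v b `\ 0) u.
  rewrite dotBr dotZr ee' (dotC e) -/a; apply; field; lra.
split; last by move=> u0; move: vu; rewrite u0 -(scale0r 0) dotZr; lra.
rewrite /cone/= vu scale1r mulr1.
rewrite (_ : u - v = - ((a / norm2 e' ^+ 2) *: e')); last first.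
  by rewrite /u addrAC subrr add0r.
rewrite norm2N norm2Z normrM normfV normrX (ger0_norm (norm2_ge0 _)).
rewrite (_ : _ * _ = `|a| / norm2 e'); last by field; lra.
by rewrite ltr_pdivrMr.
Qed.

End euclidean.

(** Admissible jumps use the closed cone, so that they form a closed relation. *)
Definition closed_cone (R : realType) N (v : 'rV[R]_N) (alpha : R) : set 'rV[R]_N :=
  [set u | norm2 (u - dot v u *: v) <= tan alpha * dot v u].

(** Steepness of e with respect to the angle b gives a margin for all vectors u of
    the narrower cone of angle a: writing e = c v + e' and u = d v + u', the term
    <e', u'> is at most |e'||u'| <= (|c| / tan b)(tan a * d), a fixed proportion
    tan a / tan b < 1 of |c| d. The sign is that of c. *)
Lemma cone_dual_le (R : realType) N (v e : 'rV[R]_N) (a b : R) :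
  norm2 v = 1 -> 0 < tan a -> tan a < tan b ->
  tan b * norm2 (e - dot v e *: v) <= `|dot v e| ->
  exists sg : bool, forall u, closed_cone v a u ->
    (tan b - tan a) / (1 + tan b) * norm2 e * dot v u <= (-1) ^+ sg * dot e u.
Proof.
move=> v1 a0 ab.
set T := tan b in ab *; set t := tan a in a0 ab *.
set c := dot v e; set e' := e - c *: v => e'c.
exists (c < 0) => u; rewrite /closed_cone/=; set d := dot v u; set u' := u - d *: v => u'd.
rewrite -/t in u'd.
have d0 : 0 <= d.
  by rewrite -(pmulr_rge0 _ a0) (le_trans (norm2_ge0 _) u'd).
have eu : dot e u = c * d + dot e' u'.
  rewrite /e' dotBl dotZl dot_orth_proj// /u' dotBr dotZr (dotC e v) -/c; lra.
have h1 : - (norm2 e' * norm2 u') <= (-1) ^+ (c < 0)%R * dot e' u'.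
  have := cauchy_schwarz e' u'; have := cauchy_schwarz (- e') u'.
  by rewrite norm2N -scaleN1r dotZl; case: (c < 0)%R; rewrite ?expr1 ?expr0; lra.
have h2 : (-1) ^+ (c < 0)%R * c = `|c|.
  by rewrite mulr_sign; case: ltrP => c0; [rewrite ltr0_norm | rewrite ger0_norm].
have h3 : norm2 e <= `|c| + norm2 e'.
  have -> : e = c *: v + e' by rewrite /e' addrC subrK.
  apply: (le_trans (norm2D _ _)).
  rewrite {1}(_ : e' = e - c *: v)// norm2Z v1; lra.
have T1 : 0 < 1 + T by lra.
have e'0 := norm2_ge0 e'; have u'0 := norm2_ge0 u'.
rewrite eu mulrDr mulrA h2.
rewrite (_ : _ * _ * d = (T - t) * norm2 e * d / (1 + T)); last by field; lra.
rewrite ler_pdivrMr//.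
have h4 : norm2 e' * norm2 u' <= norm2 e' * (t * d) by rewrite ler_wpM2l.
suff : (T - t) * norm2 e * d <= (`|c| * d - norm2 e' * (t * d)) * (1 + T).
  move=> /le_trans; apply; rewrite ler_pM2r//; lra.
suff : (T - t) * norm2 e <= (`|c| - norm2 e' * t) * (1 + T).
  by move=> h; have := ler_wpM2r d0 h; nra.
have h5 : (T - t) * norm2 e <= (T - t) * (`|c| + norm2 e') by rewrite ler_wpM2l//; lra.
suff : (T - t) * (`|c| + norm2 e') <= (`|c| - norm2 e' * t) * (1 + T) by lra.
nra.
Qed.

(** N free vectors span the space, so e is a combination of them and <e, e> = 0. *)
Lemma free_row_orth (R : realType) N (u : 'I_N -> 'rV[R]_N) (e : 'rV[R]_N) :
  free [tuple u i | i < N] -> (forall i, dot e (u i) = 0) -> e = 0.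
Proof.
move=> fu eu.
have bu : basis_of fullv [tuple u i | i < N].
  rewrite basisEfree fu subvf dimvf size_tuple /= (_ : dim _ = N) ?leqnn//; exact: mul1n.
apply: norm2_eq0; apply/eqP; rewrite -sqrf_eq0 sqr_norm2.
rewrite {2}(coord_basis bu (memvf e)) /dot.
rewrite -/(dot e _); elim/big_rec: _ => [|i w _ /eqP ew].
  by rewrite -(scale0r 0) dotZr mul0r.
by rewrite dotDr dotZr ew (nth_map i) ?size_enum_ord// nth_ord_enum eu mulr0 addr0.
Qed.

(** For e <> 0 the cones cannot all contain a nonzero vector orthogonal to e:
    choosing one in each cone would give a free family inside a hyperplane. One cone
    of angle alpha_i + theta thus avoids this hyperplane, and the cone of angle
    alpha_i keeps away from it by a margin that does not depend on e. *)
Lemma independent_cones_escape (R : realType) N (v : 'I_N -> 'rV[R]_N)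
    (alpha : 'I_N -> R) (theta : R) :
  (forall i, norm2 (v i) = 1) -> (forall i, 0 < alpha i) -> 0 < theta ->
  (forall i, alpha i + theta < pi / 2) ->
  independent_cones (fun i => cone (v i) (alpha i + theta)) ->
  exists2 c : R, 0 < c & forall e, e != 0 -> exists i (sg : bool), forall u,
    closed_cone (v i) (alpha i) u -> c * norm2 e * dot (v i) u <= (-1) ^+ sg * dot e u.
Proof.
move=> v1 a0 th0 athpi ind.
have pi0 : 0 < pi / 2 :> R by rewrite divr_gt0 ?pi_gt0.
pose T i := tan (alpha i + theta); pose t i := tan (alpha i).
have t0 i : 0 < t i.
  by rewrite -tan0 ltr_tan// in_itv/=; have := a0 i; have := athpi i; lra.
have tT i : t i < T i.
  by rewrite ltr_tan// ?in_itv/=; have := a0 i; have := athpi i; lra.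
pose ci i := (T i - t i) / (1 + T i).
have ci0 i : 0 < ci i by rewrite divr_gt0//; have := t0 i; have := tT i; lra.
exists (\big[Num.min/1]_i ci i).
  by elim/big_ind: _ => // x y x0 y0; rewrite lt_min x0.
move=> e e0.
have [i he] : exists i, forall u, (cone (v i) (alpha i + theta) `\ 0) u -> dot e u != 0.
  apply: contrapT => /forallNP h.
  have /choice[u hu] : forall i, exists u, (cone (v i) (alpha i + theta) `\ 0) u /\ dot e u = 0.
    move=> i; have /existsNP[u /not_implyP[uC /negP/negPn/eqP eu]] := h i.
    by exists u.
  by move/eqP: e0; apply; apply: (@free_row_orth _ _ u) => [|i]; [apply: ind => i; case: (hu i)|case: (hu i)].
have := cone_orth_steep (v1 i) _ he => /(_ (lt_trans (t0 i) (tT i))).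
move=> /(cone_dual_le (v1 i) (t0 i) (tT i))[sg hsg].
exists i, sg => u uC; apply: le_trans (hsg u uC).
rewrite ler_wpM2r//; last first.
  rewrite ler_wpM2r ?norm2_ge0//; exact: bigmin_le_cond.
by rewrite -(pmulr_rge0 _ (t0 i)) (le_trans (norm2_ge0 _) uC).
Qed.

(** * Walks made of admissible jumps *)

Section walks.
Context {R : realType} {X : metricType R} {N : nat}.
Variables (f : X -> 'rV[R]_N) (v : 'I_N -> 'rV[R]_N) (alpha : 'I_N -> R).
Variable delta : R.

(** The admissible jumps. The factor 2 leaves room for choosing the end of the jump
    in a set of parameters of positive density, and delta / 2 instead of
    delta absorbs the errors in the difference quotients. *)
Definition step (s : R) (i : 'I_N) (sg : bool) (x x' : X) : Prop :=
  [/\ s <= mdist x x' <= 2 * s,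
      closed_cone (v i) (alpha i) ((-1) ^+ sg *: (f x' - f x))
    & delta / 2 * mdist x x' <= dot (v i) ((-1) ^+ sg *: (f x' - f x))].

(** A strategy tree: the direction and the sign of each jump may be chosen after
    seeing where the previous jumps led. *)
Fixpoint walk (k : nat) (s : R) (x : X) : Prop :=
  if k is k'.+1 then forall i sg, exists2 x', step s i sg x x' & walk k' s x'
  else True.

Hypothesis f_lip : euclid_lipschitz f.
Hypothesis delta0 : 0 < delta.
Variable c : R.
Hypothesis c0 : 0 < c.
Hypothesis escape : forall e, e != 0 -> exists i (sg : bool), forall u,
    closed_cone (v i) (alpha i) u -> c * norm2 e * dot (v i) u <= (-1) ^+ sg * dot e u.

(** With E = W - f x and u the increment of f, |E - u|^2 = |E|^2 - 2 <E, u> + |u|^2.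
    The choice of direction and sign makes <E, u> at least c |E| (delta/2) d, while
    |u|^2 <= L^2 d^2 is negligible as soon as d is small compared with |E|. *)
Lemma walk_step_closer : exists2 c1 : R, 0 < c1 & forall (W : 'rV[R]_N) (x : X) s,
  0 < s -> s <= c1 * norm2 (W - f x) ->
  exists i sg, forall x', step s i sg x x' ->
    norm2 (W - f x') <= norm2 (W - f x) - c * delta / 4 * s.
Proof.
have [L0 fL0] := f_lip.
(* Replaces the Lipschitz constant, which may be negative, by one that is at least 1. *)
pose L := Num.max L0 1.
have L1 : 1 <= L by rewrite le_max lexx orbT.
have fL x y : norm2 (f x - f y) <= L * mdist x y.
  apply: (le_trans (fL0 x y)); rewrite ler_wpM2r ?mdist_ge0//.
  by rewrite le_max lexx.
have cd0 : 0 < c * delta by rewrite mulr_gt0.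
exists (c * delta / (4 * L ^+ 2)).
  by rewrite divr_gt0// mulr_gt0// exprn_gt0//; lra.
move=> W x s s0; set E := W - f x => sE.
have E0 : E != 0.
  apply/eqP => E0; move: sE; rewrite E0 norm20 mulr0; lra.
have [i [sg hsg]] := escape E0.
exists i, sg => x' [/andP[sd ds] xC xd].
set d := mdist x x' in sd ds xd.
set u := f x' - f x in xC xd.
have -> : W - f x' = E - u by rewrite /E /u opprB addrA subrK.
have nE0 := norm2_gt0 E0.
set nE := norm2 E in sE nE0 *.
have hEu : c * nE * (delta / 2 * d) <= dot E u.
  rewrite (_ : dot E u = (-1) ^+ sg * dot E ((-1) ^+ sg *: u)); last first.
    by rewrite dotZr mulrA -expr2 sqrr_sign mul1r.
  by apply: le_trans (hsg _ xC); rewrite ler_wpM2l// mulr_ge0// ltW.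
have hu : norm2 u ^+ 2 <= L ^+ 2 * d ^+ 2.
  rewrite -exprMn ler_pXn2r ?nnegrE ?norm2_ge0//; last first.
    by rewrite mulr_ge0 ?mdist_ge0//; lra.
  by rewrite /u /d metric_sym fL.
have hL : L ^+ 2 * d <= c * delta / 2 * nE.
  have : L ^+ 2 * d <= L ^+ 2 * (2 * s) by rewrite ler_wpM2l// sqr_ge0.
  move=> /le_trans; apply.
  move: sE; rewrite mulrAC ler_pdivlMr; last by rewrite mulr_gt0// exprn_gt0//; lra.
  nra.
have dd : dot (E - u) (E - u) <= nE ^+ 2 - c * delta / 2 * nE * s.
  rewrite sqr_normB -/nE.
  have : L ^+ 2 * d * d <= c * delta / 2 * nE * d by rewrite ler_wpM2r//; lra.
  have : c * delta / 2 * nE * s <= c * delta / 2 * nE * d.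
    by rewrite ler_wpM2l// mulr_ge0//; lra.
  lra.
have Es : c * delta / 2 * s <= nE.
  have := le_trans (dot_ge0 _) dd.
  rewrite (_ : _ - _ = nE * (nE - c * delta / 2 * s)); last by ring.
  by rewrite pmulr_rge0// subr_ge0.
apply: norm2_le; first by have : 0 < c * delta * s by [rewrite mulr_gt0]; lra.
apply: (le_trans dd).
have := sqr_ge0 (c * delta / 4 * s); lra.
Qed.

(** Jumping towards W until f is within rho of it or the walk ends. Each jump costs
    at most 2s of distance in X and gains c delta s / 4 in the image, so the total
    displacement is controlled by the total gain, however many jumps are made. *)
Lemma walk_descent : exists2 c1 : R, 0 < c1 & forall (W : 'rV[R]_N) rho s,
  0 < rho -> 0 < s -> s <= c1 * rho -> forall k x, walk k s x ->
  exists x', c * delta / 8 * mdist x x' <= norm2 (W - f x) - norm2 (W - f x') /\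
    (norm2 (W - f x') <= rho \/
     norm2 (W - f x') <= norm2 (W - f x) - k%:R * (c * delta / 4 * s)).
Proof.
have cd0 : 0 < c * delta by rewrite mulr_gt0.
have [c1 c10 closer] := walk_step_closer.
exists c1 => // W rho s rho0 s0 src; elim => [|k IH] x /= wx.
  by exists x; rewrite mdistxx; split; [lra|right; lra].
have [Erho|Erho] := leP (norm2 (W - f x)) rho.
  by exists x; rewrite mdistxx; split; [lra|left].
have [|i [sg hx]] := closer W x s s0.
  by apply: (le_trans src); rewrite ler_pM2l// ltW.
have [x1 xx1 wx1] := wx i sg.
have E1 := hx _ xx1.
have [x' [dx' Ex']] := IH _ wx1.
exists x'; split.
  have [/andP[_ d2] _ _] := xx1.
  have := metric_triangle x x1 x'.
  rewrite -(ler_pM2l (_ : 0 < c * delta / 8)); last lra.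
  have : c * delta / 8 * mdist x x1 <= c * delta / 8 * (2 * s).
    by rewrite ler_pM2l//; lra.
  rewrite mulrDr; lra.
case: Ex' => Ex'; [by left|right].
by rewrite -natr1; lra.
Qed.

(** With jumps of scale comparable to eps r, the number k of jumps needed depends on
    eps and not on r, so that walks of one fixed length suffice for all small r. The
    bound M on the displacement does not depend on eps. *)
Lemma walk_reach p :
  (forall k, exists2 s0 : R, 0 < s0 & forall s, 0 < s < s0 -> walk k s p) ->
  forall w : 'rV[R]_N, exists2 M : R, 0 <= M & forall eps, 0 < eps ->
  exists2 r0 : R, 0 < r0 & forall r, 0 < r < r0 ->
  exists x, mdist p x <= M * r /\ norm2 (f p + r *: w - f x) <= eps * r.
Proof.
move=> wp w.
have cd0 : 0 < c * delta by rewrite mulr_gt0.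
have [c1 c10 desc] := walk_descent.
exists (8 / (c * delta) * norm2 w).
  by rewrite mulr_ge0 ?norm2_ge0// divr_ge0// ltW.
move=> eps eps0.
pose k := (Num.truncn (norm2 w / (c * delta / 4 * (c1 * eps)))).+1.
have ce0 : 0 < c * delta / 4 * (c1 * eps) by rewrite !mulr_gt0//; lra.
have hk : norm2 w <= k%:R * (c * delta / 4 * (c1 * eps)).
  by rewrite -ler_pdivrMr//; apply/ltW/truncnS_gt.
have [s0 s00 ws] := wp k.
exists (s0 / (c1 * eps)); first by rewrite divr_gt0// mulr_gt0.
move=> r /andP[r0]; rewrite ltr_pdivlMr ?mulr_gt0// => rs.
have cer : 0 < r * (c1 * eps) by rewrite !mulr_gt0.
have [||||x [dx Ex]] := desc (f p + r *: w) (eps * r) (r * (c1 * eps)) _ _ _ k p.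
- by rewrite mulr_gt0.
- by [].
- lra.
- by apply: ws; rewrite cer.
have Ep : norm2 (f p + r *: w - f p) = r * norm2 w.
  by rewrite addrAC subrr add0r norm2Z gtr0_norm.
exists x; rewrite Ep in dx Ex; split.
  rewrite (_ : _ * r = r * norm2 w / (c * delta / 8)); last by field; rewrite !gt_eqF.
  rewrite ler_pdivlMr; last lra.
  have := norm2_ge0 (f p + r *: w - f x); lra.
case: Ex => // /le_trans; apply.
have : r * norm2 w <= r * (k%:R * (c * delta / 4 * (c1 * eps))) by rewrite ler_pM2l.
have := mulr_gt0 eps0 r0; lra.
Qed.

End walks.

(** * Values of a blow-up *)

(** Used to turn statements about every precision eps into a single sequence,
    without extracting subsequences. *)
Lemma near_minimizer (R : realType) (T : Type) (A : set T) (h : T -> R) (e : R) :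
  A !=set0 -> (forall x, A x -> 0 <= h x) -> 0 < e ->
  exists2 x, A x & forall y, A y -> h x <= h y + e.
Proof.
move=> [a Aa] h0 e0.
have lb : has_lbound (h @` A) by exists 0 => _ [x Ax <-]; exact: h0.
have [|_ [x Ax <-] hx] := @inf_adherent R (h @` A) e e0.
  by split=> //; exists (h a); exists a.
exists x => // y Ay; apply: (le_trans (ltW hx)); rewrite lerD2r.
by apply: ge_inf => //; exists y.
Qed.

Lemma edist_inf_lt_mdist (R : realType) (Z : metricType R) (A : set Z) z (r : R) :
  (edist_inf A z < r%:E)%E -> exists2 a, A a & mdist z a < r.
Proof.
move=> /ereal_inf_lt[_ [a Aa <-]] /edist_lt_ball; rewrite ballEmdist/=.
by exists a.
Qed.

Lemma sup_edist_inf_cvg0 (R : realType) (Z : metricType R) (A B : nat -> set Z) :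
  ereal_sup [set edist_inf (B n) y | y in A n] @[n --> \oo] --> 0%E ->
  forall e : R, 0 < e -> \forall n \near \oo,
    forall y, A n y -> exists2 b, B n b & mdist y b < e.
Proof.
move=> AB e e0.
have nb : nbhs (0%:E : \bar R) [set y | (y < e%:E)%E].
  by apply: open_nbhs_nbhs; split; [exact: open_ereal_lt_ereal|rewrite /= lte_fin].
have sup_lt : \forall n \near \oo,
    (ereal_sup [set edist_inf (B n) y | y in A n] < e%:E)%E by exact: (AB _ nb).
apply: filterS sup_lt => n supe y Ay; apply: edist_inf_lt_mdist.
by apply: le_lt_trans supe; apply: ereal_sup_ubound; exists y.
Qed.

(** The traces on Y of the balls around u form a Cauchy filter. *)
Lemma complete_isometric_image (R : realType) (Y Z : metricType R) (j : Y -> Z) u :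
  complete_space Y -> (forall x y, mdist (j x) (j y) = mdist x y) ->
  (forall e : R, 0 < e -> exists y, mdist u (j y) < e) -> exists y, j y = u.
Proof.
move=> cY jiso hu.
pose F := filter_from [set e : R | 0 < e] (fun e => [set y | mdist u (j y) < e]).
have FF : ProperFilter F.
  apply: filter_from_proper; last first.
    by move=> e /= /hu[y uy]; exists y.
  apply: filter_from_filter; first by exists 1 => /=.
  move=> e1 e2 /= e10 e20; exists (Num.min e1 e2) => /=.
    by rewrite lt_min e10.
  by move=> y /=; rewrite lt_min => /andP[].
have [|y Fy] := cY F FF.
  apply: cauchy_exP => e e0; have [|y uy] := hu (e / 2); first by rewrite divr_gt0.
  exists y; exists (e / 2); first by rewrite /= divr_gt0.
  move=> y' /= uy'; rewrite ballEmdist/= -jiso.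
  by have := metric_triangle (j y) u (j y'); rewrite (metric_sym (j y) u); lra.
exists y; apply: mdist_positivity; apply/eqP; rewrite eq_le mdist_ge0 andbT.
apply/ler_addgt0Pl => e e0; rewrite addr0.
have e20 : 0 < e / 2 by rewrite divr_gt0.
have Fb : F (ball y (e / 2)) by apply: Fy; exact: nbhsx_ballx.
have Fu : F [set y | mdist u (j y) < e / 2] by exists (e / 2).
have [y' []] := filter_ex (filterI Fb Fu).
rewrite ballEmdist/= -jiso (metric_sym u) => h1 h2.
by have := metric_triangle (j y) (j y') u; lra.
Qed.

(** The points x_n nearly minimize the distance from f to f(p) + t_n w among the
    points at distance at most M t_n of p, the points y_n nearly minimize the
    distance to x_n in Y, and u is a cluster point of the y_n. Since u is the image
    of some y' in Y, points p'_n of X approximating y' exist for all n, and they are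
    close to x_n, at scale t_n, for infinitely many n. The rescaled increments of f
    at p'_n converge to g(y'), those at x_n converge to w, and f is Lipschitz. *)
Lemma blowup_value (R : realType) (X : metricType R) (p : X) N
    (f : X -> 'rV[R]_N) (Y : metricType R) (q : Y) (g : Y -> 'rV[R]_N)
    (w : 'rV[R]_N) (M : R) :
  euclid_lipschitz f -> 0 <= M ->
  (forall eps, 0 < eps -> exists2 r0 : R, 0 < r0 & forall r, 0 < r < r0 ->
     exists x, mdist p x <= M * r /\ norm2 (f p + r *: w - f x) <= eps * r) ->
  Tan p f q g -> exists y, g y = w.
Proof.
move=> [L0 fL0] M0 reach [cY _ _ [t [Z [z [iota [j [t0 tcvg real blow]]]]]]].
pose L := Num.max L0 1.
have L1 : 1 <= L by rewrite le_max lexx orbT.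
have fL x y : norm2 (f x - f y) <= L * mdist x y.
  apply: (le_trans (fL0 x y)); rewrite ler_wpM2r ?mdist_ge0//.
  by rewrite le_max lexx.
have [Zproper isoX isoY baseX baseY YX XY] := real.
have tsmall e : 0 < e -> \forall n \near \oo, t n < e.
  by move=> e0; apply: cvgr_lt tcvg _ _.
(* Any error that is o(t n) would do in place of t n ^+ 2. *)
have /choice[x hx] n : exists xn : X, mdist p xn <= M * t n /\
    forall y, mdist p y <= M * t n ->
    norm2 (f p + t n *: w - f xn) <= norm2 (f p + t n *: w - f y) + t n ^+ 2.
  have [|||xn pxn hxn] := @near_minimizer R X [set y | mdist p y <= M * t n]
    (fun y => norm2 (f p + t n *: w - f y)) (t n ^+ 2).
  - by exists p; rewrite /= mdistxx mulr_ge0// ltW.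
  - by move=> *; exact: norm2_ge0.
  - by rewrite exprn_gt0.
  - by exists xn.
have xsmall e : 0 < e -> \forall n \near \oo,
    norm2 (f p + t n *: w - f (x n)) <= e * t n.
  move=> e0; have e20 : 0 < e / 2 by rewrite divr_gt0.
  have [r0 r00 hr0] := reach _ e20.
  near=> n.
  have tn2 : t n < e / 2 by near: n; exact: tsmall.
  have tr0 : 0 < t n < r0 by rewrite t0/=; near: n; exact: tsmall.
  have [y [py fy]] := hr0 _ tr0.
  have [_ /(_ y py)] := hx n; have := t0 n; nra.
have zx n : mdist z (iota n (x n)) <= M.
  rewrite -(baseX n) isoX mulrC ler_pdivrMr//; exact: (hx n).1.
have /choice[y hy] n : exists yn : Y, forall y,
    mdist (iota n (x n)) (j yn) <= mdist (iota n (x n)) (j y) + t n.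
  have [|||yn _ hyn] := @near_minimizer R Y setT (fun y => mdist (iota n (x n)) (j y)) (t n).
  - by exists q.
  - by move=> *; exact: mdist_ge0.
  - exact: t0.
  - by exists yn => y; exact: hyn.
have ysmall e : 0 < e -> \forall n \near \oo, mdist (iota n (x n)) (j (y n)) < e.
  move=> e0; have e20 : 0 < e / 2 by rewrite divr_gt0.
  have M10 : 0 < M + 1 by lra.
  have XYe := sup_edist_inf_cvg0 (XY _ M10) e20.
  apply: filterS2 (tsmall _ e20) XYe => n tn XYn.
  have [|_ [y' _ <-] xy'] := XYn (iota n (x n)).
    by split; [rewrite ballEmdist/=; have := zx n; lra|exists (x n)].
  by have := hy n y'; lra.
have jyball : \forall n \near \oo, mdist z (j (y n)) <= M + 1.
  apply: filterS (ysmall _ ltr01) => n h.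
  by have := metric_triangle z (iota n (x n)) (j (y n)); have := zx n; lra.
have [|u [_ cu]] := Zproper z (M + 1) ((fun n => j (y n)) @ \oo) _.
  exact: jyball.
(* Clustering at u, stated for indices rather than for values, so that other
   eventual properties of the index can be required at the same time. *)
have often (E : set nat) e : 0 < e -> (\forall n \near \oo, E n) ->
    exists2 n, E n & mdist u (j (y n)) < e.
  move=> e0 En.
  have [||_ [[n En' <-]]] := cu [set j (y n) | n in E] (ball u e).
  - by apply: filterS En => n En; exists n.
  - exact: nbhsx_ballx.
  - by rewrite ballEmdist/= => un; exists n.
have [e e0|y' jy'] := complete_isometric_image cY isoY (u := u).
  by have [n _ un] := often setT e e0 filterT; exists (y n).
have /choice[p' hp'] n : exists x', forall x,
    mdist u (iota n x') <= mdist u (iota n x) + t n.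
  have [|||xn _ hxn] := @near_minimizer R X setT (fun x => mdist u (iota n x)) (t n).
  - by exists p.
  - by move=> *; exact: mdist_ge0.
  - exact: t0.
  - by exists xn => x'; exact: hxn.
have psmall e : 0 < e -> \forall n \near \oo, mdist u (iota n (p' n)) < e.
  move=> e0; have e20 : 0 < e / 2 by rewrite divr_gt0.
  have z0 : 0 < mdist z u + 1 by have := mdist_ge0 z u; lra.
  have YXe := sup_edist_inf_cvg0 (YX _ z0) e20.
  apply: filterS2 (tsmall _ e20) YXe => n tn YXn.
  have [|_ [x' _ <-] xy'] := YXn u.
    by split; [rewrite ballEmdist/=; lra|exists y'].
  by have := hp' n x'; lra.
have gcvg : (t n)^-1 *: (f (p' n) - f p) @[n --> \oo] --> g y'.
  by apply: blow; rewrite jy'; apply/metricType_numDomainType.cvgrPdist_lt.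
exists y'; apply: contrapT => gw.
pose D := norm2 (w - g y').
have D0 : 0 < D.
  by apply: norm2_gt0; apply/eqP => /subr0_eq wg; apply: gw.
have Dcont : continuous ((fun a => norm2 (w - a)) : 'rV[R]_N -> R^o).
  move=> a; apply: (@continuous_comp _ _ _ (fun a : 'rV[R]_N => w - a)
    (@norm2 R N : 'rV[R]_N -> R^o)).
    by apply: continuousB; [exact: cst_continuous|move=> *; exact: cvg_id].
  exact: norm2_continuous.
have Dcvg : norm2 (w - (t n)^-1 *: (f (p' n) - f p)) @[n --> \oo] --> (D : R^o).
  exact: (cvg_comp _ _ gcvg (Dcont (g y'))).
have eta0 : 0 < D / (8 * L) by rewrite divr_gt0//; lra.
have D40 : 0 < D / 4 by rewrite divr_gt0.
have D2 : \forall n \near \oo,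
   D * (7 / 8) < norm2 (w - (t n)^-1 *: (f (p' n) - f p)).
  by apply: (cvgr_gt _ Dcvg); lra.
have [n [[h1 h2] [h3 h4]] h5] := often _ _ eta0
  (filterI (filterI D2 (xsmall _ D40)) (filterI (ysmall _ eta0) (psmall _ eta0))).
have tn0 := t0 n.
have dxp : mdist (x n) (p' n) <= t n * (3 * (D / (8 * L))).
  rewrite -ler_pdivrMl// -isoX.
  have := metric_triangle (iota n (x n)) (j (y n)) (iota n (p' n)).
  have := metric_triangle (j (y n)) u (iota n (p' n)).
  rewrite (metric_sym (j (y n)) u); lra.
have {}dxp : L * mdist (x n) (p' n) <= t n * (3 / 8 * D).
  have := ler_wpM2l (ltW (lt_le_trans ltr01 L1)) dxp => /le_trans; apply.
  by rewrite le_eqVlt; apply/orP; left; apply/eqP; field; lra.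
have fxp := fL (x n) (p' n).
have := norm2D (f p + t n *: w - f (x n)) (f (x n) - f (p' n)).
rewrite addrA subrK.
have -> : f p + t n *: w - f (p' n) = t n *: (w - (t n)^-1 *: (f (p' n) - f p)).
  by rewrite scalerBr scalerA divff ?gt_eqF// scale1r opprB addrCA addrA addrAC.
rewrite norm2Z gtr0_norm//.
move: h1; rewrite -(ltr_pM2l tn0); have := mulr_gt0 tn0 D0; lra.
Unshelve. all: by end_near. Qed.

(** * Null sets and density points of the line *)

Lemma diam_ge0 (R : realType) (X : metricType R) (A : set X) : (0 <= diam A)%E.
Proof. by apply: ereal_sup_ubound; left. Qed.

Lemma diam_le (R : realType) (X : metricType R) (A : set X) (r : \bar R) :
  (0 <= r)%E -> (forall x y, A x -> A y -> (mdist x y)%:E <= r)%E ->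
  (diam A <= r)%E.
Proof.
move=> r0 Ar; apply: ge_ereal_sup => _ [->//|[[x y] [/= Ax Ay] <-]].
exact: Ar.
Qed.

Lemma wlength_ocitv (R : realType) (I : set (ocitv_type R)) :
  measurable I -> forall a b : R, I a -> I b -> (`|a - b|%:E <= wlength idfun I)%E.
Proof.
move=> [[l u] _ <-] a b /=; rewrite !in_itv/= => /andP[la au] /andP[lb bu].
rewrite (@wlength_itv_bnd R idfun l u false false) ?lee_fin; last first.
  by rewrite (le_trans (ltW la)).
by rewrite ler_norml; apply/andP; split => /=; lra.
Qed.

(** A Lebesgue-null set has countable covers by intervals of arbitrarily small total
    length; this also makes each interval short, as the definition of H^1 asks. The
    images of these intervals cover S. *)
Lemma hausdorff1_lipschitz_null (R : realType) (X : metricType R) (K : set R)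
    (gamma : K -> X) (L : R) (S : set X) :
  0 < L -> (forall s t, mdist (gamma s) (gamma t) <= L * `|val s - val t|) ->
  lebesgue_measure.-negligible [set val t | t in gamma @^-1` S] ->
  S `<=` range gamma ->
  hausdorff1 S = 0%E.
Proof.
move=> L0 gL [E [mE E0 SE]] Sg.
apply/eqP; rewrite eq_le; apply/andP; split; last first.
  apply: (@le_trans _ _ (hausdorff1_delta 1 S)); last first.
    by apply: ereal_sup_ubound; exists 1 => //=.
  apply: le_ereal_inf_tmp => _ [U _ <-].
  by apply: nneseries_ge0 => n _ _; exact: diam_ge0.
apply: ge_ereal_sup => _ [delta /= delta0 <-].
apply/lee_addgt0Pr => eps eps0; rewrite add0e.
pose e := Num.min eps delta / L.
have e0 : 0 < e by rewrite divr_gt0// lt_min eps0.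
have : (lebesgue_measure E < e%:E)%E by rewrite E0 lte_fin.
move=> /ereal_inf_lt[_ [I [mI EI] <-] sumI].
have I0 k : (0 <= wlength idfun (I k))%E by exact: wlength_ge0.
have term k : (wlength idfun (I k) <= e%:E)%E.
  apply: le_trans (ltW sumI); rewrite (@nneseriesD1 R (fun k => wlength idfun (I k)) k xpredT)//.
  by rewrite leeDl// nneseries_ge0.
have diamI k : (diam (gamma @` [set t | I k (val t)]) <= L%:E * wlength idfun (I k))%E.
  apply: diam_le; first by rewrite mule_ge0// lee_fin ltW.
  move=> _ _ [s Is <-] [t It <-].
  apply: (@le_trans _ _ (L * `|val s - val t|)%:E); first by rewrite lee_fin.
  by rewrite EFinM lee_pmul2l//; apply: wlength_ocitv.
have Le : L * e = Num.min eps delta by rewrite /e mulrC divfK// gt_eqF.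
apply: (@le_trans _ _ (\sum_(0 <= k <oo) diam (gamma @` [set t | I k (val t)]))%E).
  apply: ereal_inf_lbound; exists (fun k => gamma @` [set t | I k (val t)]) => //.
  split=> [k|x Sx].
    apply: (le_trans (diamI k)); apply: (@le_trans _ _ (L * e)%:E).
      by rewrite EFinM lee_pmul2l.
    by rewrite lee_fin Le ge_min lexx orbT.
  have [t _ gt] := Sg _ Sx.
  have [|k _ Ik] := EI (val t).
    by apply: SE; exists t => //=; rewrite gt.
  by exists k => //; exists t.
apply: (@le_trans _ _ (\sum_(0 <= k <oo) (L%:E * wlength idfun (I k)))%E).
  by apply: lee_nneseries => *; [exact: diam_ge0|exact: diamI].
rewrite nneseriesZl//; apply: (@le_trans _ _ (L * e)%:E).
  by rewrite EFinM lee_pmul2l// ltW.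
by rewrite lee_fin Le ge_min lexx.
Qed.

(** The arithmetic of the next lemma: a set that misses an interval of length h/3
    inside an interval of length 4h has density at most 11/12 in the latter. *)
Lemma window_arith (R : realType) (A : \bar R) (h : R) : 0 < h ->
  A \is a fin_num -> ((11 / 12)%:E < A * (2 * h *+ 2)%:E^-1)%E ->
  (A + (h / 6 *+ 2)%:E <= (2 * h *+ 2)%:E)%E -> False.
Proof.
move=> h0; case: A => [a| |]// _; have h40 : 0 < 2 * h *+ 2 by rewrite mulrn_wgt0//; lra.
rewrite inver gt_eqF// -EFinM -EFinD lte_fin lee_fin ltr_pdivlMr//.
by rewrite -(mulr_natr (2 * h)) -(mulr_natr (h / 6)); lra.
Qed.

(** A set which misses, on one side of t, the interval of the points at distance
    between 4h/3 and 5h/3 of t for arbitrarily small h does not have density 1 at t. *)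
Lemma density_window (R : realType) (E : set R) : measurable E ->
  {ae lebesgue_measure, forall t : R, E t -> exists2 h0 : R, 0 < h0 &
    forall h (sg : bool), 0 < h < h0 ->
      exists2 s, E s & 4 / 3 * h <= (-1) ^+ sg * (s - t) <= 5 / 3 * h}.
Proof.
move=> mE; have := lebesgue_density mE.
apply: filter_app; first exact: (ae_filter_ringOfSetsType lebesgue_measure).
apply: aeW => t dens Et.
rewrite indicE mem_set//= in dens.
have /dens : nbhs (1%:E : \bar R) [set y | ((11 / 12)%:E < y)%E].
  by apply: open_nbhs_nbhs; split; [exact: open_ereal_gt_ereal|rewrite /= lte_fin; lra].
move=> /nbhs_ballP[e /= e0 he].
exists (e / 2); first by rewrite divr_gt0.
move=> h sg /andP[h0 he2].
have r0 : 0 < 2 * h by lra.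
have := he (2 * h) _ r0.
rewrite -ball_normE/= sub0r normrN gtr0_norm// => /(_ _)/wrap[]; first lra.
rewrite lebesgue_measure_ball ?(ltW r0)// => big.
apply: contrapT => /forall2NP noE.
(* The centre of the window, whose radius is h / 6. *)
pose c := t + (-1) ^+ sg * (3 / 2 * h).
have sub : (E `&` ball t (2 * h)) `|` ball c (h / 6) `<=` ball t (2 * h).
  move=> s []; first by case.
  rewrite -!ball_normE/= /c => cs.
  have := ler_normD (t - (t + (-1) ^+ sg * (3 / 2 * h))) (t + (-1) ^+ sg * (3 / 2 * h) - s).
  rewrite addrA subrK opprD addrA subrr add0r normrN normrM normr_sign mul1r.
  rewrite (ger0_norm (_ : 0 <= 3 / 2 * h)); lra.
have disj : (E `&` ball t (2 * h)) `&` ball c (h / 6) = set0.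
  rewrite -subset0 => s [[Es _]]; rewrite -ball_normE/= /c => cs.
  have [//|] := noE s; apply; apply/andP.
  by move: cs; rewrite ltr_norml => /andP[]; case: sg {c sub noE}; rewrite ?expr1 ?expr0; lra.
have mball (x r : R) : measurable (ball x r : set (measurableTypeR R)) by exact: measurable_ball.
have mEb : measurable (E `&` ball t (2 * h) : set (measurableTypeR R)).
  by apply: measurableI => //; exact: mball.
have le4h : (lebesgue_measure (E `&` ball t (2 * h)) + (h / 6 *+ 2)%:E <= (2 * h *+ 2)%:E)%E.
  rewrite -(lebesgue_measure_ball t (ltW r0)) -(lebesgue_measure_ball c (r := h / 6)); last lra.
  rewrite -(measureU _ mEb (mball c _) disj).
  by apply: le_measure; rewrite ?inE//; exact: measurableU.
have Afin : lebesgue_measure (E `&` ball t (2 * h)) \is a fin_num.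
  rewrite ge0_fin_numE ?measure_ge0//; apply: (@le_lt_trans _ _ (2 * h *+ 2)%:E).
    by apply: le_trans le4h; rewrite leeDl// lee_fin mulrn_wge0// divr_ge0// ltW.
  by rewrite ltry.
exact: (window_arith h0 Afin big le4h).
Qed.

(** * Jumps along a fragment *)

Lemma near_punctured_dom (R : realType) (K : set R) (t : K) (P : set K) :
  (\forall s \near t^', P s) -> exists2 eta : R, 0 < eta &
    forall s : K, val s != val t -> `|val s - val t| < eta -> P s.
Proof.
move=> /nbhs_ballP[eta /= eta0 h]; exists eta => // s st s_eta.
apply: h; last by apply: contra_neq st => ->.
by rewrite -initial_ballE /= -ball_normE/= distrC.
Qed.

Section frag_steps.
Context {R : realType} {X : metricType R} {N : nat}.
Variables (f : X -> 'rV[R]_N) (v : 'I_N -> 'rV[R]_N) (alpha : 'I_N -> R).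
Variables (delta : R) (delta0 : 0 < delta).

Lemma cone_nbhs (w l : 'rV[R]_N) a : cone w a l -> \forall u \near l, cone w a u.
Proof.
rewrite /cone/= => cl.
have c1 : continuous (fun u : 'rV[R]_N => u - dot w u *: w).
  move=> u; apply: (@cvgB _ _ _ (nbhs u)); first exact: cvg_id.
  by apply: (@cvgZr_tmp _ _ _ (nbhs u)); exact: (@dot_continuous R N w u).
have c2 : continuous ((fun u => norm2 (u - dot w u *: w)) : 'rV[R]_N -> R^o).
  by move=> u; exact: (cvg_comp _ _ (c1 u) (@norm2_continuous R N _)).
have cont : continuous ((fun u => tan a * dot w u - norm2 (u - dot w u *: w)) : 'rV[R]_N -> R^o).
  move=> u; apply: (@cvgB _ R^o _ (nbhs u) _ (fun u => tan a * dot w u)); last exact: c2.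
  exact: (@cvgZl_tmp R R^o _ (nbhs u) _ (tan a) (dot w) _ (@dot_continuous R N w u)).
have : 0 < tan a * dot w l - norm2 (l - dot w l *: w) by rewrite subr_gt0.
move=> /(cvgr_gt _ (cont l)); apply: filterS => u.
by rewrite subr_gt0.
Qed.

(** Look for the endpoint at a parameter r with |r - t| between 4h/3 and 5h/3 where
    h = s / m, m being the metric speed at t: its distance to the image of t is m |r - t|
    up to a small relative error, hence between s and 2s. The increment of f is
    |r - t| times a vector close to l, which stays in the open cone; the sign is
    the side of t on which r lies. *)
Lemma frag_steps (gamma : frag X) (t : dom gamma) (S : set X) (i : 'I_N)
    (l : 'rV[R]_N) (l' m h0 : R) :
  0 < h0 ->
  (forall h (sg : bool), 0 < h < h0 ->
    exists2 s, [set val s | s in gamma @^-1` S] s &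
      4 / 3 * h <= (-1) ^+ sg * (s - val t) <= 5 / 3 * h) ->
  is_frag_derive f t l -> cone (v i) (alpha i) l ->
  is_frag_derive ((fun x => dot (v i) (f x)) : X -> R^o) t l' ->
  is_md t m -> delta * m <= l' ->
  exists2 s0, 0 < s0 & forall s sg, 0 < s < s0 ->
    exists2 x', S x' & step f v alpha delta s i sg (gamma t) x'.
Proof.
move=> h00 window fl cl hl' hm dml.
have [L L0 Lg] := frag_bilipschitz gamma.
have Li0 : 0 < L^-1 by rewrite invr_gt0.
have speed_near k : 0 < k -> exists2 eta : R, 0 < eta &
    forall s : dom gamma, val s != val t -> `|val s - val t| < eta ->
    `|m - mdist (gamma s) (gamma t) / `|val s - val t| | < k.
  move=> k0; apply: near_punctured_dom.
  by move/cvgrPdist_lt : hm; apply.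
(* The fragment is bi-Lipschitz and t is not isolated in its domain, so its
   metric speed is at least L^-1. *)
have m0 : 0 < m.
  rewrite ltNge; apply/negP => m0.
  have [|eta eta0 heta] := speed_near (L^-1 / 2); first by rewrite divr_gt0.
  pose h := Num.min h0 eta / 2.
  have me0 : 0 < Num.min h0 eta by rewrite lt_min h00.
  have hh : h < h0 /\ h < eta / 2 + eta / 2 /\ 2 * h <= eta.
    have h1 : Num.min h0 eta <= h0 by rewrite ge_min lexx.
    have h2 : Num.min h0 eta <= eta by rewrite ge_min lexx orbT.
    by rewrite /h; lra.
  have hp : 0 < h by rewrite divr_gt0.
  have [|_ [s Ss <-]] := window h false; first by case: hh => hh _; rewrite hp.
  rewrite expr0 mul1r => /andP[h1 h2].
  have st : val s != val t by rewrite -subr_eq0 gt_eqF//; lra.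
  have sta : `|val s - val t| = val s - val t by rewrite ger0_norm//; lra.
  have := heta s st; rewrite sta ltr_norml => /(_ _)/wrap[]; first lra.
  move=> /andP[h3 _]; have /andP[h4 _] := Lg s t.
  move: h4; rewrite sta -ler_pdivlMr; last lra.
  lra.
(* A relative error 1/5 turns the window [4/3, 5/3] into distances within [1, 2],
   and the second bound gives delta m - k >= (delta / 2) (m + k). *)
pose k := Num.min (m / 5) (delta * m / (2 + delta)).
have k0 : 0 < k by rewrite lt_min; apply/andP; split; rewrite divr_gt0 ?mulr_gt0 ?addr_gt0.
have km : k <= m / 5 by rewrite ge_min lexx.
have kd : k * (2 + delta) <= delta * m.
  by rewrite -ler_pdivlMr ?addr_gt0// ge_min lexx orbT.
have [e1 e10 h1] := speed_near _ k0.
have [e2 e20 h2] : exists2 eta : R, 0 < eta &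
    forall s : dom gamma, val s != val t -> `|val s - val t| < eta ->
    `|l' - (val s - val t)^-1 *
        (dot (v i) (f (gamma s)) - dot (v i) (f (gamma t)))| < k.
  by apply: near_punctured_dom; move/cvgrPdist_lt : hl'; apply.
have [e3 e30 h3] : exists2 eta : R, 0 < eta &
    forall s : dom gamma, val s != val t -> `|val s - val t| < eta ->
    cone (v i) (alpha i) ((val s - val t)^-1 *: (f (gamma s) - f (gamma t))).
  by apply: near_punctured_dom; exact: (fl _ (cone_nbhs cl)).
pose e := Num.min (Num.min h0 e1) (Num.min e2 e3).
have e0 : 0 < e by rewrite !lt_min h00 e10 e20.
have [eh ee1 ee2 ee3] : [/\ e <= h0, e <= e1, e <= e2 & e <= e3].
  by rewrite /e !ge_min !lexx ?orbT.
exists (m * e / 2) => [|s sg /andP[s0 se]]; first by rewrite !mulr_gt0.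
pose h := s / m.
have hm' : h * m = s by rewrite /h divfK// gt_eqF.
have hp : 0 < h by rewrite divr_gt0.
have he : h < e / 2 by rewrite /h ltr_pdivrMr//; lra.
have [|_ [r Sr <-]] := window h sg; first lra.
set tau := (-1) ^+ sg * _ => /andP[tau1 tau2].
have tau0 : 0 < tau by lra.
have tauE : `|val r - val t| = tau.
  by rewrite -[LHS]mul1r -(normr_sign _ sg) -normrM gtr0_norm.
have rt : val r != val t.
  by rewrite -subr_eq0 -normr_eq0 tauE gt_eqF.
have {}h1 := h1 r rt; have {}h2 := h2 r rt; have {}h3 := h3 r rt.
rewrite tauE in h1 h2 h3.
have {}h1 := h1 ltac:(lra); have {}h2 := h2 ltac:(lra); have {}h3 := h3 ltac:(lra).
exists (gamma r) => //.
set u := (_ *: _) in h3.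
have uE : (-1) ^+ sg *: (f (gamma r) - f (gamma t)) = tau *: u.
  rewrite /u scalerA /tau -mulrA divff ?mulr1//.
  by rewrite subr_eq0.
have d1 : (m - k) * tau <= mdist (gamma t) (gamma r) <= (m + k) * tau.
  move: h1; rewrite metric_sym ltr_norml => /andP[h1l h1r]; apply/andP; split.
    by rewrite -ler_pdivlMr//; lra.
  by rewrite -ler_pdivrMr//; lra.
have dotu : delta * m - k <= dot (v i) u.
  have -> : dot (v i) u = (val r - val t)^-1 * (dot (v i) (f (gamma r)) - dot (v i) (f (gamma t))).
    by rewrite /u dotZr dotBr.
  by move: h2; rewrite ltr_norml => /andP[]; lra.
have dd : delta / 2 * (m + k) <= dot (v i) u by nra.
split.
- move: d1 => /andP[d1 d2]; apply/andP; split.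
    apply: le_trans d1; rewrite -hm'.
    have : (m - m / 5) * (4 / 3 * h) <= (m - k) * tau.
      by apply: ler_pM; lra.
    have := mulr_gt0 m0 hp; nra.
  apply: (le_trans d2); rewrite -hm'.
  have : (m + k) * tau <= (m + m / 5) * (5 / 3 * h).
    by apply: ler_pM; lra.
  lra.
- rewrite uE /closed_cone/= dotZr -scalerA -scalerBr norm2Z gtr0_norm//.
  by rewrite mulrCA ler_pM2l// ltW.
- rewrite uE dotZr; move: d1 => /andP[_ d2].
  apply: (@le_trans _ _ (delta / 2 * ((m + k) * tau))).
    by apply: ler_wpM2l => //; rewrite divr_ge0// ltW.
  by rewrite mulrA mulrC ler_pM2l.
Qed.

End frag_steps.

(** * Compactness of the cores *)

Lemma mdist_continuous (R : realType) (X : metricType R) :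
  continuous ((fun z => mdist z.1 z.2) : X * X -> R^o).
Proof.
move=> [x y]; apply/cvgrPdist_lt => e e0.
have e20 : 0 < e / 2 by rewrite divr_gt0.
exists (ball x (e / 2), ball y (e / 2)).
  by split; exact: nbhsx_ballx.
move=> [x' y'] /= []; rewrite !ballEmdist/= => xx' yy'.
have h1 := metric_triangle x x' y; have h2 := metric_triangle x' y' y.
have h3 := metric_triangle x' x y'; have h4 := metric_triangle x y y'.
rewrite (metric_sym y' y) in h2; rewrite (metric_sym x' x) in h3.
by rewrite ltr_norml; apply/andP; split; lra.
Qed.

Lemma euclid_lipschitz_continuous (R : realType) (X : metricType R) N
  (f : X -> 'rV[R]_N) : euclid_lipschitz f -> continuous f.
Proof.
move=> [L fL] x; apply/cvgrPdist_lt => e e0.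
have L0 : 0 < Num.max L 1 by rewrite lt_max ltr01 orbT.
apply/nbhs_ballP; exists (e / Num.max L 1); first by rewrite /= divr_gt0.
move=> y; rewrite /= ballEmdist/= ltr_pdivlMr// => xy.
apply: le_lt_trans xy; apply: (le_trans (ler_norm_norm2 _)).
apply: (le_trans (fL _ _)); rewrite mulrC ler_wpM2l ?mdist_ge0//.
by rewrite le_max lexx.
Qed.

Section step_core.
Context {R : realType} {X : metricType R} {N : nat}.
Variables (f : X -> 'rV[R]_N) (v : 'I_N -> 'rV[R]_N) (alpha : 'I_N -> R).
Variables (delta : R).
Hypothesis f_lip : euclid_lipschitz f.

(** The set J restricts the directions and signs that are asked for: a single pair
    for a single Alberti representation, all pairs for the walks. *)
Definition step_core (J : set ('I_N * bool)) (S : set X) (n : nat) : set X :=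
  S `&` [set x | forall i sg s, J (i, sg) -> 0 < s < n.+1%:R^-1 ->
    exists2 x', S x' & step f v alpha delta s i sg x x'].

Lemma closed_step s i sg :
  closed [set z : X * X | step f v alpha delta s i sg z.1 z.2].
Proof.
pose w (z : X * X) := (-1) ^+ sg *: (f z.2 - f z.1).
have wc : continuous w.
  move=> z; apply: (@cvgZl_tmp _ _ _ (nbhs z)); apply: (@cvgB _ _ _ (nbhs z)).
    exact: (cvg_comp _ _ (@cvg_snd _ _ (nbhs z.1) (nbhs z.2) _) (euclid_lipschitz_continuous f_lip (x := z.2))).
  exact: (cvg_comp _ _ (@cvg_fst _ _ (nbhs z.1) (nbhs z.2) _) (euclid_lipschitz_continuous f_lip (x := z.1))).
pose d (z : X * X) : R^o := mdist z.1 z.2.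
have dc : continuous d by exact: mdist_continuous.
pose b (z : X * X) : R^o := dot (v i) (w z).
have bc : continuous b.
  by move=> z; exact: (cvg_comp _ _ (wc z) (@dot_continuous R N (v i) (w z))).
pose o (z : X * X) : R^o := norm2 (w z - dot (v i) (w z) *: v i).
have oc : continuous o.
  have oc' : continuous (fun z => w z - dot (v i) (w z) *: v i).
    move=> z; apply: (@cvgB _ _ _ (nbhs z)); first exact: wc.
    by apply: (@cvgZr_tmp _ _ _ (nbhs z)); exact: bc.
  by move=> z; exact: (cvg_comp _ _ (oc' z) (@norm2_continuous R N _)).
have closed_le0 (phi psi : X * X -> R^o) : continuous phi -> continuous psi ->
    closed [set z | phi z <= psi z].
  move=> phic psic.
  rewrite (_ : [set z | _] = (fun z => psi z - phi z) @^-1` [set y : R^o | 0 <= y]).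
    apply: preimage_closed; last exact: closed_ge.
    by move=> z _; apply: (@cvgB _ R^o _ (nbhs z)); [exact: psic|exact: phic].
  by apply/seteqP; split => z /=; rewrite subr_ge0.
have cstc (r : R) : continuous ((fun=> r) : X * X -> R^o) by move=> z; exact: cvg_cst.
have scal (r : R) (phi : X * X -> R^o) : continuous phi ->
    continuous ((fun z => r * phi z) : X * X -> R^o).
  by move=> phic z; exact: (@cvgZl_tmp R R^o _ (nbhs z) _ r phi _ (phic z)).
rewrite (_ : [set z | _] =
  ([set z | (s : R^o) <= d z] `&` [set z | d z <= (2 * s : R^o)]) `&`
  ([set z | o z <= tan (alpha i) * b z] `&` [set z | delta / 2 * d z <= b z])).
  by apply: closedI; apply: closedI; apply: closed_le0 => //; exact: scal.
apply/seteqP; split => z /=.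
  by move=> [/andP[sd ds] c1 c2].
by move=> [[sd ds] [c1 c2]]; split => //; apply/andP.
Qed.

(** For each direction, sign and scale, the points of S from which a jump into S
    exists form the projection of a compact set, because the end of the jump is
    sought in the compact set S; the core is an intersection of such projections. *)
Lemma compact_step_core J S n : compact S -> compact (step_core J S n).
Proof.
move=> cS; apply: (subclosed_compact _ cS); last by move=> x [].
have clS : closed S by apply: compact_closed => //; exact: metric_hausdorff.
pose G i sg s := [set z.1 | z in (S `*` S) `&` [set z : X * X | step f v alpha delta s i sg z.1 z.2]].
rewrite (_ : step_core J S n = S `&` \bigcap_(k in
    [set k : 'I_N * bool * R | J k.1 /\ 0 < k.2 < n.+1%:R^-1]) G k.1.1 k.1.2 k.2).
  apply: closedI => //; apply: closed_bigI => k _.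
  apply: compact_closed; first exact: metric_hausdorff.
  apply: continuous_compact.
    by apply: continuous_subspaceT => z; exact: (@cvg_fst _ _ (nbhs z.1) (nbhs z.2) _).
  by apply: compact_closedI; [exact: compact_setX|exact: closed_step].
apply/seteqP; split => x [Sx] h; split => //.
  move=> [[i sg] s] /= [Jk sn]; have [x' Sx' xx'] := h i sg s Jk sn.
  by exists (x, x').
move=> i sg s Jk sn; have [[y x'] [[_ /= Sx'] yx'] <-] := h ((i, sg), s) (conj Jk sn).
by exists x'.
Qed.

End step_core.

(** * Fragments and null sets *)

Import HBNNSimple.

(** Every simple function below h vanishes almost everywhere. *)
Lemma ge0_integral_ae0 d (T : measurableType d) (R : realType)
    (P : {measure set T -> \bar R}) (h : T -> \bar R) :
  (forall x, 0 <= h x)%E -> (\forall x \ae P, h x = 0%E) ->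
  (\int[P]_x h x = 0)%E.
Proof.
move=> h0 [E [mE PE hE]].
rewrite ge0_integralTE//; apply/eqP; rewrite eq_le; apply/andP; split; last first.
  by apply: ereal_sup_ubound; exists (cst_nnsfun T (0%:nng)); rewrite /= ?sintegral0.
apply: ge_ereal_sup => _ [phi /= phih <-].
rewrite -integralT_nnsfun (@ae_eq_integral _ _ _ P setT (cst 0%E))//.
- by rewrite integral0.
- by apply/measurable_EFinP; exact: measurable_funP.
- exists E; split => // x /= phix; apply: hE => /= hx; apply: phix => _.
  have := phih x; rewrite hx lee_fin => phi0.
  by congr EFin; apply/eqP; rewrite eq_le phi0 fun_ge0.
Qed.

Lemma closed_frag_preimage (R : realType) (X : metricType R) (gamma : frag X)
  (S : set X) : closed S -> closed [set val t | t in gamma @^-1` S].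
Proof.
move=> clS r rE.
have [L L0 Lg] := frag_bilipschitz gamma.
have domr : dom gamma r.
  have := compact_closed (@Rhausdorff R) (@dom_compact _ _ gamma); apply.
  move=> B /rE[_ [[t _ <-] Bt]]; exists (val t); split => //; exact: set_valP.
pose t : dom gamma := @exist _ _ r (mem_set domr).
exists t => //; apply: clS => B /nbhs_ballP[e /= e0 eB].
have [_ [[s Ss <-] rs]] := rE _ (nbhsx_ballx r (e / L) (divr_gt0 e0 L0)).
exists (gamma s); split => //; apply: eB; rewrite ballEmdist/=.
have /andP[_ h] := Lg t s; apply: (le_lt_trans h).
by move: rs; rewrite -ball_normE/= ltr_pdivlMr// mulrC.
Qed.

Section alberti_cores.
Context d {R : realType} {X : metricMeasurableType d R} {N : nat}.
Variable mu : {measure set X -> \bar R}.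
Variables (f : X -> 'rV[R]_N) (v : 'I_N -> 'rV[R]_N) (alpha : 'I_N -> R).
Variables (delta : R).
Hypothesis delta0 : 0 < delta.

(** The exceptional parameters are those where a derivative is missing and those
    that are not density points. *)
Lemma frag_core_ae (gamma : frag X) (S : set X) i sg : closed S ->
  ae_dom (fun t : dom gamma =>
    exists2 l, is_frag_derive f t l & cone (v i) (alpha i) l) ->
  ae_dom (fun t : dom gamma => exists l m,
    [/\ is_frag_derive ((fun x => dot (v i) (f x)) : X -> R^o) t l, is_md t m
      & delta * m <= l]) ->
  lebesgue_measure.-negligible [set val t | t in gamma @^-1`
    (S `\` \bigcup_n step_core f v alpha delta [set (i, sg)] S n)].
Proof.
move=> clS dir spd.
have mE : measurable ([set val t | t in gamma @^-1` S] : set (measurableTypeR R)).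
  by apply: closed_measurable; exact: closed_frag_preimage.
have win := density_window mE.
apply: negligibleS (negligibleU (negligibleU dir spd) win).
move=> _ [t [St nT] <-]; apply: contrapT => /not_orP[/not_orP[]].
move=> ndir nspd /contrapT /(_ (ex_intro2 _ _ t St erefl))[h0 h00 window].
have [l fl cl] : exists2 l, is_frag_derive f t l & cone (v i) (alpha i) l.
  by apply: contrapT => h; apply: ndir; exists t.
have [l' [m [hl' hm dml]]] : exists l m,
    [/\ is_frag_derive ((fun x => dot (v i) (f x)) : X -> R^o) t l, is_md t m
      & delta * m <= l].
  by apply: contrapT => h; apply: nspd; exists t.
have [s0 s00 hs0] := frag_steps delta0 h00 window fl cl hl' hm dml.
apply: nT; exists (Num.truncn s0^-1) => //; split => // _ _ s [-> ->] /andP[sp ss].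
apply: hs0; rewrite sp (lt_trans ss)// invf_plt ?posrE// truncnS_gt//.
Qed.

(** Absolute continuity with respect to H^1 on the image of each fragment makes B null
    for almost every nu_gamma, and these measures integrate to mu. *)
Lemma alberti_null (A : alberti mu) (B : set (borelType X)) : measurable B ->
  (\forall gamma \ae alb_P A, lebesgue_measure.-negligible
     [set val t | t in (gamma : frag X) @^-1` B]) ->
  mu B = 0%E.
Proof.
move=> mB nullB; rewrite (alb_disintegration A)//.
apply: ge0_integral_ae0 => [gamma|]; first exact: measure_ge0.
apply: (negligibleS _ nullB) => gamma; apply: contra_not => nB.
have [L L0 Lg] := frag_bilipschitz gamma.
apply: (@alb_abs_cont _ _ _ _ A gamma B) => // C mC CB.
apply: (@hausdorff1_lipschitz_null _ _ _ gamma L) => //.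
- by move=> s t; case/andP: (Lg s t).
- apply: negligibleS nB => _ [t [Ct _] <-]; exists t => //; exact: CB.
Qed.

End alberti_cores.

(** * Walks from almost every point *)

Lemma borel_measurable_sub d (R : realType) (X : metricMeasurableType d R) :
  (forall O : set X, open O -> measurable O) ->
  forall B : set (borelType X), measurable B -> d.-measurable (B : set X).
Proof.
move=> mO B; apply: smallest_sub; last by move=> O; exact: mO.
exact: sigma_algebra_measurable.
Qed.

Lemma closed_borel (T : ptopologicalType) (S : set T) :
  closed S -> measurable (S : set (borelType T)).
Proof.
move=> cS; rewrite -[S]setCK; apply: measurableC.
by apply: sub_sigma_algebra; exact: closed_openC.
Qed.

Section walks_ae.
Context d {R : realType} {X : metricMeasurableType d R} {N : nat}.
Variable mu : {measure set X -> \bar R}.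
Variables (f : X -> 'rV[R]_N) (v : 'I_N -> 'rV[R]_N) (alpha : 'I_N -> R).
Variables (delta : R) (A : 'I_N -> alberti mu).
Hypothesis delta0 : 0 < delta.
Hypothesis open_mu : forall O : set X, open O -> measurable O.
Hypothesis f_lip : euclid_lipschitz f.
Hypothesis A_dir : forall i, in_direction (A i) f (cone (v i) (alpha i)).
Hypothesis A_speed : forall i, has_speed_ge (A i) (fun x => dot (v i) (f x)) delta.

Local Notation core := (step_core f v alpha delta).

Lemma core_single_null i sg S : compact S ->
  mu.-negligible (S `\` \bigcup_n core [set (i, sg)] S n).
Proof.
move=> cS.
have clS : closed S by apply: compact_closed => //; exact: metric_hausdorff.
have mB : measurable (S `\` \bigcup_n core [set (i, sg)] S n : set (borelType X)).
  apply: measurableD; first exact: closed_borel.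
  apply: bigcup_measurable => n _; apply: closed_borel.
  apply: compact_closed; first exact: metric_hausdorff.
  exact: compact_step_core.
apply/negligibleP; first exact: borel_measurable_sub.
apply: (alberti_null (A := A i)) => //.
apply: (negligibleS _ (negligibleU (A_dir i) (A_speed i))) => gamma.
apply: contra_notP => /not_orP[/contrapT dir /contrapT spd].
exact: frag_core_ae.
Qed.

(** There are finitely many directions and signs, and the cores increase with n. *)
Lemma core_null S : compact S ->
  mu.-negligible (S `\` \bigcup_n core setT S n).
Proof.
move=> cS.
have h : \forall x \ae mu, forall k : 'I_N * bool,
    S x -> (\bigcup_n core [set k] S n) x.
  apply: filter_forall => -[i sg].
  apply: negligibleS (core_single_null i sg cS) => x /= /not_implyP[Sx nx].
  by split.
apply: negligibleS h => x [Sx ncore] /= h; apply: ncore.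
have /choice[n hn] k : exists n, core [set k] S n x.
  by have [n _ ?] := h k Sx; exists n.
exists (\max_k n k)%N => //; split => // i sg s _ /andP[s0 sn].
have [_] := hn (i, sg); apply => //; rewrite s0 (lt_le_trans sn)//.
by rewrite lef_pV2 ?posrE// ler_nat ltnS (leq_bigmax (i, sg)).
Qed.

(** The induction replaces S with the cores of S: a point of a core jumps into S,
    where walks of length k are available, and thus starts walks of length k + 1 at
    scales below a bound that is uniform on the core. *)
Lemma walks_ae_aux j k s1 S : compact S -> 0 < s1 ->
  (forall x s, S x -> 0 < s < s1 -> walk f v alpha delta k s x) ->
  mu.-negligible [set x | S x /\ ~ exists2 s0 : R, 0 < s0 &
    forall s, 0 < s < s0 -> walk f v alpha delta (k + j) s x].
Proof.
elim: j k s1 S => [|j IH] k s1 S cS s10 hS.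
  apply: negligibleS (negligible_set0 mu) => x [Sx]; apply.
  by exists s1 => // s ss; rewrite addn0; exact: hS.
have step_null n : mu.-negligible [set x | core setT S n x /\ ~ exists2 s0 : R, 0 < s0 &
    forall s, 0 < s < s0 -> walk f v alpha delta (k.+1 + j) s x].
  apply: (IH k.+1 (Num.min s1 n.+1%:R^-1)).
  - exact: compact_step_core.
  - by rewrite lt_min s10 invr_gt0 ltr0n.
  - move=> x s [Sx hx] /andP[s0]; rewrite lt_min => /andP[ss1 sn] i sg.
    have [|x' Sx' xx'] := hx i sg s I; first by rewrite s0.
    by exists x' => //; apply: hS => //; rewrite s0.
apply: negligibleS (negligibleU (core_null cS) (negligible_bigcup step_null)).
move=> x [Sx nx]; have [[n _ xn]|xn] := pselect ((\bigcup_n core setT S n) x).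
  by right; exists n => //; split => //; rewrite addSnnS.
by left.
Qed.

Lemma walks_ae k S : compact S ->
  mu.-negligible [set x | S x /\ ~ exists2 s0 : R, 0 < s0 &
    forall s, 0 < s < s0 -> walk f v alpha delta k s x].
Proof. by move=> cS; apply: (@walks_ae_aux k 0 1). Qed.

End walks_ae.

(** * Exhaustion by compact sets *)

Lemma diam_ub (R : realType) (X : metricType R) (A : set X) x y :
  A x -> A y -> ((mdist x y)%:E <= diam A)%E.
Proof. by move=> Ax Ay; apply: ereal_sup_ubound; right; exists (x, y). Qed.

(** Finite Assouad dimension makes bounded sets totally bounded, so that X has
    countable covers by sets of small diameter. The i-th piece of the ball of
    radius n + 1 is indexed by n and i. *)
Lemma assouad_countable_cover (R : realType) (X : metricType R) (x0 : X) (e : R) :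
  (assouad_dim X < +oo)%E -> 0 < e ->
  exists W : nat -> nat -> set X, (forall x, exists n i, W n i x) /\
    forall n i x y, W n i x -> W n i y -> mdist x y <= e.
Proof.
move=> /ereal_inf_lt[_ [D [C cov] <-] _] e0.
have /choice[W hW] n : exists U : nat -> set X,
    [set x | mdist x0 x <= n.+1%:R] `<=` \bigcup_i U i /\
    forall i x y, U i x -> U i y -> mdist x y <= e.
  pose r : R := 2 * n.+1%:R.
  have r0 : 0 < r by rewrite mulr_gt0.
  pose eps := Num.min (1 / 2) (e / r).
  have eps0 : 0 < eps by rewrite lt_min !divr_gt0.
  have eps1 : eps < 1.
    by rewrite (@le_lt_trans _ _ (1 / 2))// ?ge_min ?lexx//; lra.
  have epsr : eps * r <= e by rewrite -ler_pdivlMr// ge_min lexx orbT.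
  have [||k _ [U dU covU]] := cov eps r _ r0 [set x | mdist x0 x <= n.+1%:R].
  - by rewrite eps0.
  - apply: diam_le; first by rewrite lee_fin ltW.
    move=> x y /= x0x x0y; rewrite lee_fin.
    by have := metric_triangle x x0 y; rewrite (metric_sym x x0) /r; lra.
  exists (fun i => if insub i is Some i' then U i' else set0); split.
    move=> x /covU[i _ Uix]; exists (i : nat) => //.
    by rewrite insubT// => ilt; rewrite (_ : Sub _ _ = i)//; exact: val_inj.
  move=> i x y; case: insubP => // i' _ _ Ux Uy.
  rewrite -lee_fin; apply: (le_trans (diam_ub Ux Uy)); apply: (le_trans (dU i')).
  by rewrite lee_fin.
exists W; split => [x|n]; last exact: (hW n).2.
have [|i _ Wx] := (hW (Num.truncn (mdist x0 x))).1 x.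
  by rewrite /= ltW// truncnS_gt.
by exists (Num.truncn (mdist x0 x)), i.
Qed.

(** Each piece of the countable covers of scale 1/(k+1) that is contained in some
    open set of finite measure selects one such open set. Around every point there is
    an open set of finite measure, which contains the piece of the point at a small
    enough scale. *)
Lemma finite_open_cover d (R : realType) (X : metricMeasurableType d R)
    (mu : {measure set X -> \bar R}) :
  (assouad_dim X < +oo)%E ->
  (forall x : X, exists2 O : set X, open_nbhs x O & (mu O < +oo)%E) ->
  exists O : nat -> set X, [/\ forall n, open (O n), forall n, (mu (O n) < +oo)%E
    & \bigcup_n O n = setT].
Proof.
move=> dimX fin.
have /choice[W hW] : forall k : nat, exists W : nat -> nat -> set X,
    (forall x, exists n i, W n i x) /\
    forall n i x y, W n i x -> W n i y -> mdist x y <= k.+1%:R^-1.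
  move=> k; apply: (assouad_countable_cover (point : X) dimX).
  by rewrite invr_gt0.
pose good k n i (O : set X) := [/\ open O, (mu O < +oo)%E & W k n i `<=` O].
have /choice[G hG] : forall m, exists O : set X,
    [/\ open O, (mu O < +oo)%E & forall k n i, unpickle m = Some (k, n, i) ->
       (exists O', good k n i O') -> W k n i `<=` O].
  move=> m; case: (@unpickle (nat * nat * nat)%type m) => [[[k n] i]|].
    have [[G1 [oG mG WG]]|nG] := pselect (exists O', good k n i O').
      by exists G1; split => // _ _ _ [<- <- <-].
    exists set0; split; [exact: open0|by rewrite measure0|].
    by move=> _ _ _ [<- <- <-].
  by exists set0; split; [exact: open0|by rewrite measure0|].
exists G; split => [n|n|]; [by case: (hG n)..|].
apply/seteqP; split => // x _.
have [G' [oG' G'x] mG'] := fin x.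
have /nbhs_ballP[e /= e0 eG'] : nbhs x G' by exact: open_nbhs_nbhs.
pose k := Num.truncn e^-1.
have ke : k.+1%:R^-1 < e by rewrite invf_plt ?posrE// truncnS_gt.
have [n [i Wx]] := (hW k).1 x.
exists (pickle (k, n, i)) => //.
have [_ _ /(_ k n i)] := hG (pickle (k, n, i)).
rewrite pickleK => /(_ erefl); apply; last exact: Wx.
exists G'; split => // y Wy; apply: eG'; rewrite ballEmdist/=.
by apply: le_lt_trans ke; exact: (hW k).2 Wx Wy.
Qed.

Lemma radon_exhaust d (R : realType) (X : metricMeasurableType d R)
    (mu : {measure set X -> \bar R}) (B : set X) :
  radon mu -> measurable B -> (mu B < +oo)%E ->
  exists K : nat -> set X, (forall n, compact (K n) /\ K n `<=` B) /\
    mu.-negligible (B `\` \bigcup_n K n).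
Proof.
move=> [mO _ inner] mB finB.
have finB' : mu B \is a fin_num by rewrite ge0_fin_numE ?measure_ge0.
have mK (K : set X) : compact K -> measurable K.
  move=> /(compact_closed (@metric_hausdorff _ _)) cK.
  by rewrite -[K]setCK; apply: measurableC; apply: mO; exact: closed_openC.
have /choice[K hK] n : exists K : set X, [/\ compact K, K `<=` B &
    (mu (B `\` K) <= n.+1%:R^-1%:E)%E].
  have n0 : 0 < n.+1%:R^-1 :> R by rewrite invr_gt0.
  have := @ub_ereal_sup_adherent R [set mu K | K in [set K | compact K /\ K `<=` B]] _ n0.
  rewrite -inner// => /(_ finB')[_ [K [cK KB] <-] BK]; exists K; split => //.
  rewrite measureD// ?mK//; last exact: mK.
  rewrite setIidr// leeBlDr ?ge0_fin_numE ?measure_ge0//; last first.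
    by apply: le_lt_trans finB; apply: le_measure; rewrite ?inE//; exact: mK.
  by rewrite addeC -leeBlDr// ltW.
exists K; split => [n|]; first by have [] := hK n.
have mUK : measurable (\bigcup_n K n).
  by apply: bigcup_measurable => n _; apply: mK; have [] := hK n.
apply/negligibleP; first exact: measurableD.
apply/eqP; rewrite eq_le measure_ge0 andbT; apply/lee_addgt0Pr => e e0.
rewrite add0e; have [_ _ hn] := hK (Num.truncn e^-1).
apply: (@le_trans _ _ (mu (B `\` K (Num.truncn e^-1)))).
  apply: le_measure; rewrite ?inE; [exact: measurableD| |].
    by apply: measurableD => //; apply: mK; have [] := hK (Num.truncn e^-1).
  by move=> x [Bx nx]; split => // Kx; apply: nx; exists (Num.truncn e^-1).
apply: (le_trans hn); rewrite lee_fin ltW//.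
by rewrite invf_plt ?posrE// truncnS_gt.
Qed.

(** Produces Borel sets from measurable ones: the measurable sets of X may be more
    than the Borel sets, and the set of full measure in the theorem has to be Borel. *)
Lemma radon_sigma_compact d (R : realType) (X : metricMeasurableType d R)
    (mu : {measure set X -> \bar R}) (M : set X) :
  radon mu -> (assouad_dim X < +oo)%E -> measurable M ->
  exists K : nat -> set X, (forall n, compact (K n) /\ K n `<=` M) /\
    mu.-negligible (M `\` \bigcup_n K n).
Proof.
move=> rmu dimX mM; have [mO fin _] := rmu.
have [G [oO finO covO]] := finite_open_cover dimX fin.
have /choice[K hK] m : exists K : nat -> set X,
    (forall n, compact (K n) /\ K n `<=` M `&` G m) /\
    mu.-negligible ((M `&` G m) `\` \bigcup_n K n).
  apply: radon_exhaust => //; first by apply: measurableI => //; exact: mO.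
  apply: le_lt_trans (finO m); apply: le_measure; rewrite ?inE//.
  - by apply: measurableI => //; exact: mO.
  - exact: mO.
pose K' (l : nat) := if unpickle l is Some (m, n) then K m n else set0.
exists K'; split => [l|].
  rewrite /K'; case: unpickle => [[m n]|]; last by split => //; exact: compact0.
  by have [h _] := hK m; have [cK KM] := h n; split => // x /KM[].
apply: negligibleS (negligible_bigcup (fun m => (hK m).2)) => x [Mx nx].
have [m _ Ox] : (\bigcup_n G n) x by rewrite covO.
exists m => //; split => // -[n _ Kx]; apply: nx.
by exists (pickle (m, n)) => //; rewrite /K' pickleK.
Qed.

(** * Surjectivity of the blow-ups *)

Theorem theorem5p56 (d : measure_display) (R : realType)
    (X : metricMeasurableType d R) (mu : {measure set X -> \bar R}) (N : nat)
    (f : X -> 'rV[R]_N) (v : 'I_N -> 'rV[R]_N) (alpha : 'I_N -> R) (delta : R)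
    (A : 'I_N -> alberti mu) :
  radon mu -> measure_is_complete mu ->
  (assouad_dim X < +oo)%E ->
  euclid_lipschitz f ->
  (forall i, norm2 (v i) = 1) ->
  (forall i, 0 < alpha i < pi / 2) ->
  0 < delta ->
  (forall i, alberti_lipschitz (A i)) ->
  (forall i, in_direction (A i) f (cone (v i) (alpha i))) ->
  (forall i, has_speed_ge (A i) (fun x => dot (v i) (f x)) delta) ->
  (exists theta : R, [/\ 0 < theta, (forall i, alpha i + theta < pi / 2)
     & independent_cones (fun i => cone (v i) (alpha i + theta))]) ->
  exists U : set (borelType X),
    [/\ measurable U, mu (~` U) = 0%E
      & forall p : X, U p ->
          forall (Y : metricType R) (q : Y) (g : Y -> 'rV[R]_N),
            Tan p f q g -> set_surj [set: Y] [set: 'rV[R]_N] g].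
Proof.
move=> rmu _ dimX f_lip v1 alphapi delta0 _ A_dir A_speed
  [theta [theta0 athpi ind]].
have [mO _ _] := rmu.
have alpha0 i : 0 < alpha i by case/andP: (alphapi i).
have [c c0 escape] := independent_cones_escape v1 alpha0 theta0 athpi ind.
pose walkable k := [set p : X | exists2 s0 : R, 0 < s0 & forall s, 0 < s < s0 ->
  walk f v alpha delta k s p].
have [Z [mZ muZ badZ]] : mu.-negligible [set p | exists k, ~ walkable k p].
  have [K [cK nK]] := radon_sigma_compact rmu dimX measurableT.
  have null k n := walks_ae delta0 mO f_lip A_dir A_speed k (cK n).1.
  apply: negligibleS (negligibleU nK (negligible_bigcup
    (fun k => negligible_bigcup (null k)))).
  move=> p [k nk]; have [[n _ Kp]|nKp] := pselect ((\bigcup_n K n) p).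
    by right; exists k => //; exists n.
  by left; split.
have [K [cK nK]] := radon_sigma_compact rmu dimX (measurableC mZ).
have bU : measurable (\bigcup_n K n : set (borelType X)).
  apply: bigcup_measurable => n _; apply: closed_borel.
  by apply: compact_closed; [exact: metric_hausdorff|exact: (cK n).1].
exists (\bigcup_n K n); split => //.
  apply/negligibleP; first by apply: measurableC; exact: borel_measurable_sub.
  have nZ : mu.-negligible Z by exists Z; split.
  apply: negligibleS (negligibleU nK nZ) => p nKp.
  by have [Zp|Zp] := pselect (Z p); [right|left].
move=> p [n _ Kp] Y q g pqg w _.
have [M M0 reach] : exists2 M : R, 0 <= M & forall eps, 0 < eps ->
    exists2 r0 : R, 0 < r0 & forall r, 0 < r < r0 ->
    exists x, mdist p x <= M * r /\ norm2 (f p + r *: w - f x) <= eps * r.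
  apply: (walk_reach f_lip delta0 c0 escape) => k.
  by apply: contrapT => nk; apply: (cK n).2 _ Kp _; apply: badZ; exists k.
have [y <-] := blowup_value f_lip M0 reach pqg.
by exists y.
Qed.
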